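(* There exists a Hilbert space $X$ such that for any $\delta\in(0,\frac12)$ there exist a Tadmor--Ritt operator $T$ on $X$ which satisfies square function estimates and a constant $\kappa>0$ (which may depend on $\delta$) such that $$C(T,m,n)\ge\kappa\left(\log\frac{n+1}{m+1}\right)^{\delta}$$ for all integers $0\le m\le n$.
   Context: Operators are bounded and linear; $R(z,T)=(zI-T)^{-1}$; $\mathbb{D}$ is the open unit disc and $\|p\|_{\infty,\mathbb{D}}=\sup_{z\in\mathbb{D}}|p(z)|$. $T$ is a Tadmor--Ritt operator if $\sigma(T)\subset\overline{\mathbb{D}}$ and $\sup_{|z|>1}\|(z-1)R(z,T)\|<\infty$. An operator $T$ on a Hilbert space $X$ satisfies square function estimates if there is $K>0$ with $\sum_{k=1}^\infty k\|T^kx-T^{k-1}x\|^2\le K^2\|x\|^2$ for all $x\in X$. For integers $0\le m\le n$, $H^\infty[m,n]=\{p(z)=\sum_{k=m}^na_kz^k:a_k\in\mathbb{C}\}$ and $$C(T,m,n)=\sup\{\|p(T)\|:p\in H^\infty[m,n],\ \|p\|_{\infty,\mathbb{D}}\le1\}.$$ *)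

(* Defs.v *)
From HB Require Import structures.
From mathcomp Require Import all_boot all_order all_algebra.
From mathcomp Require Import complex.
From mathcomp Require Import all_classical all_reals all_analysis.

Set Implicit Arguments.
Unset Strict Implicit.
Unset Printing Implicit Defensive.

Import Order.TTheory GRing.Theory Num.Theory.
Import numFieldNormedType.Exports.

Local Open Scope classical_set_scope.
Local Open Scope ring_scope.
Local Open Scope complex_scope.

(* A complex Hilbert space is a complete normed space over R[i] whose norm
   comes from an inner product, linear in its first argument. *)
HB.mixin Record CompleteNormedModule_isHilbert (R : realType) X
    of CompleteNormedModule R[i] X := {
  inner : {dot X for @Num.conj R[i]};
  inner_norm : forall x : X, inner x x = `|x| ^+ 2
}.

#[short(type="hilbertType")]
HB.structure Definition Hilbert (R : realType) :=
  {X of CompleteNormedModule_isHilbert R X & CompleteNormedModule R[i] X}.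

(* Norms over R[i] take their values in R[i] (on the nonnegative real axis);
   normR is the same norm as a number of R. *)
Definition normR (R : realType) (V : normedZmodType R[i]) (x : V) : R :=
  complex.Re `|x|.

Section Operators.
Variables (R : realType) (X : hilbertType R).
Implicit Types (T : {linear X -> X}) (f : X -> X) (z : R[i]) (p : {poly R[i]}).

Definition opnorm f : \bar R :=
  ereal_sup [set (normR (f x))%:E | x in [set x : X | `|x| <= 1]].

Definition bounded_op f : Prop := (opnorm f < +oo)%E.

Definition scalar_sub z T : X -> X := fun x => z *: x - T x.

Definition resolvent_set T : set R[i] :=
  [set z | exists S : {linear X -> X},
     [/\ bounded_op S, cancel S (scalar_sub z T) & cancel (scalar_sub z T) S]].

Definition spectrum T : set R[i] := ~` resolvent_set T.

(* The inverse of zI - T when z is in the resolvent set. *)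
Definition resolvent z T : X -> X :=
  'pinv_(fun=> 0) [set: X] (scalar_sub z T).

Definition tadmor_ritt T : Prop :=
  [/\ bounded_op T,
      spectrum T `<=` [set z | `|z| <= 1] &
      (ereal_sup [set opnorm (fun x => (z - 1)%R *: resolvent z T x)%R
                 | z in [set z : R[i] | (1 < `|z|)%R]] < +oo)%E].

Definition square_function_estimates T : Prop :=
  exists2 K : R, 0 < K & forall x : X,
    (\sum_(1 <= k <oo) (k%:R * normR (iter k T x - iter k.-1 T x) ^+ 2)%:E
       <= (K ^+ 2 * normR x ^+ 2)%:E)%E.

Definition disc_norm p : \bar R :=
  ereal_sup [set (normR p.[z])%:E | z in [set z | `|z| < 1]].

Definition Hinf (m n : nat) : set {poly R[i]} :=
  [set \sum_(m <= k < n.+1) a k *: 'X^k | a in [set: nat -> R[i]]].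

Definition poly_op p T : X -> X :=
  fun x => \sum_(k < size p) p`_k *: iter k T x.

Definition Cbound T (m n : nat) : \bar R :=
  ereal_sup [set opnorm (poly_op p T)
            | p in [set p | Hinf m n p /\ (disc_norm p <= 1)%E]].

End Operators.

(* Main.v *)
Require Import Defs.
From HB Require Import structures.
From mathcomp Require Import all_boot all_order all_algebra.
From mathcomp Require Import complex.
From mathcomp Require Import all_classical all_reals all_analysis.
From mathcomp Require Import ring lra zify.

(** The idea is to diagonalize T in a basis of l2 for which changing the signs of
    N coefficients may multiply the norm by a power of N.

    For 0 < al < 1/2 let S be the convolution by the coefficients of
    (1 - z)^-al, an unbounded lower triangular operator on sequences whose
    columns lie in l2, and let T = S diag(1 - 256^-k) S^-1. The columns of S form
    a Schauder basis: the projections S P_k S^-1 onto the first k of them have,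
    below the diagonal block, the explicit kernel [proj_kernel], and it is
    bounded on l2 by Schur's test ([proj_kernel_bounded]). This is a discrete
    form of the fact that |t|^(-2 al) is a Muckenhoupt weight; it is here that
    al < 1/2 enters. Consequently S diag(f) S^-1 is bounded as soon as f has
    bounded variation ([calc_le]). For |z| > 1 the functions
    k |-> (z - 1) / (z - 1 + 256^-k) have uniformly bounded variation, which
    makes T a Tadmor-Ritt operator ([ritt_op_tadmor_ritt]).

    Since S^-1 is bounded and the columns of S all have the same norm, the
    coefficients of a vector of l2 in the basis are square-summable, and the
    square function estimates reduce to the boundedness of a scalar matrix
    whose Gram matrix decays off the diagonal ([ritt_square_function]).

    For the lower bound, take N consecutive eigenvalues. With alternating signs
    as coefficients, a combination of the corresponding N basis vectors has norm
    of order sqrt N, because of the cancellation in alternating sums of a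
    decreasing sequence. With positive coefficients bounded from below, its norm
    is at least of order N^(1/2 + al). A polynomial which is bounded on the disc
    and nearly takes the values (-1)^k at the eigenvalues maps the first vector
    to one of the second kind. Such a polynomial is a sum of differences of
    averages of consecutive monomials over blocks of geometrically growing
    degree ([alt_poly]): on the disc the differences add up absolutely to a
    bounded function, and each of them is concentrated at one eigenvalue. Since
    the eigenvalue k is resolved by degrees of order 256^k, polynomials with
    degrees between m and n can treat in this way a number N of eigenvalues which
    is of order log ((n + 1) / (m + 1)), up to an additive constant. Comparing
    the two norms yields C(T, m, n) >= K N^al ([Cbound_ge_power]), and al = delta
    proves the claim; small N are covered by the monomial z^m
    ([Cbound_ge_half]). *)

Set Implicit Arguments.
Unset Strict Implicit.
Unset Printing Implicit Defensive.

Import Order.TTheory GRing.Theory Num.Theory.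
Import numFieldNormedType.Exports.

Local Open Scope classical_set_scope.
Local Open Scope ring_scope.
Local Open Scope complex_scope.

(** * The real-valued norm *)

Section RealNorm.
Variable R : realType.
Implicit Types (z w : R[i]).

Lemma normRE (V : normedZmodType R[i]) (x : V) : (normR x)%:C = `|x|.
Proof. by rewrite /normR RRe_real// ger0_real. Qed.

Lemma normR_ge0 (V : normedZmodType R[i]) (x : V) : 0 <= normR x.
Proof. by rewrite -ler0c normRE. Qed.

Lemma normR0 (V : normedZmodType R[i]) : normR (0 : V) = 0.
Proof. by rewrite /normR normr0. Qed.

Lemma normRN (V : normedZmodType R[i]) (x : V) : normR (- x) = normR x.
Proof. by rewrite /normR normrN. Qed.

Lemma normRD (V : normedZmodType R[i]) (x y : V) :
  normR (x + y) <= normR x + normR y.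
Proof. by rewrite -lecR rmorphD/= !normRE ler_normD. Qed.

Lemma normRB (V : normedZmodType R[i]) (x y : V) :
  normR (x - y) <= normR x + normR y.
Proof. by rewrite -(normRN y) normRD. Qed.

Lemma normR_eq0 (V : normedZmodType R[i]) (x : V) : normR x = 0 -> x = 0.
Proof. by move=> x0; apply/normr0_eq0; rewrite -normRE x0. Qed.

Lemma normR_sum (V : normedZmodType R[i]) (I : Type) (r : seq I) (P : pred I)
  (F : I -> V) : normR (\sum_(i <- r | P i) F i) <= \sum_(i <- r | P i) normR (F i).
Proof.
elim/big_ind2: _ => [|x1 x2 y1 y2 h1 h2|//]; first by rewrite normR0.
by rewrite (le_trans (normRD _ _))// lerD.
Qed.

Lemma normRM z w : normR (z * w) = normR z * normR w.
Proof. by apply: complexI; rewrite normRE normrM rmorphM/= !normRE. Qed.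

Lemma normRV z : normR z^-1 = (normR z)^-1.
Proof. by apply: complexI; rewrite normRE normfV fmorphV/= !normRE. Qed.

Lemma normRX z n : normR (z ^+ n) = normR z ^+ n.
Proof. by apply: complexI; rewrite normRE normrX rmorphXn/= !normRE. Qed.

Lemma normR_real (r : R) : normR r%:C = `|r|.
Proof. by apply: complexI; rewrite normRE normc_def/= expr0n/= addr0 sqrtr_sqr. Qed.

Lemma normRZ (V : normedModType R[i]) z (x : V) :
  normR (z *: x) = normR z * normR x.
Proof. by apply: complexI; rewrite normRE normrZ rmorphM/= !normRE. Qed.

Lemma normR_sqr z : normR z ^+ 2 = complex.Re z ^+ 2 + complex.Im z ^+ 2.
Proof. by apply: complexI; rewrite add_Re2_Im2 rmorphXn/= normRE. Qed.

Lemma ReD z w : complex.Re (z + w) = complex.Re z + complex.Re w.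
Proof. by case: z => ? ?; case: w. Qed.

Lemma ImD z w : complex.Im (z + w) = complex.Im z + complex.Im w.
Proof. by case: z => ? ?; case: w. Qed.

Lemma absRe_le_normR z : `|complex.Re z| <= normR z.
Proof.
by rewrite -ler_sqr ?nnegrE ?normR_ge0// real_normK ?num_real// normR_sqr lerDl sqr_ge0.
Qed.

Lemma absIm_le_normR z : `|complex.Im z| <= normR z.
Proof.
by rewrite -ler_sqr ?nnegrE ?normR_ge0// real_normK ?num_real// normR_sqr lerDr sqr_ge0.
Qed.

Lemma normR_le_ReIm z : normR z <= `|complex.Re z| + `|complex.Im z|.
Proof.
rewrite -ler_sqr ?nnegrE ?normR_ge0 ?addr_ge0// normR_sqr.
rewrite -(real_normK (num_real (complex.Re z))) -(real_normK (num_real (complex.Im z))).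
by have := normr_ge0 (complex.Re z); have := normr_ge0 (complex.Im z); nra.
Qed.

Lemma normR_le1 (V : normedZmodType R[i]) (x : V) : (`|x| <= 1) = (normR x <= 1).
Proof. by rewrite -normRE -lecR. Qed.

End RealNorm.

(** * The space of square-summable complex sequences *)

Section SquareSummable.
Variable R : realType.
Implicit Types (x y : nat -> R[i]).

(** All estimates below are stated for these partial sums, with constants that
    do not depend on n: the operators in use are lower triangular, so that the
    first n entries of an image only depend on the first n entries of the
    argument, and no convergence question arises before the very end. *)
Definition sqsum x (n : nat) : R := \sum_(i < n) normR (x i) ^+ 2.

Lemma sqsum_ge0 x n : 0 <= sqsum x n.
Proof. by apply: sumr_ge0 => i _; rewrite exprn_ge0// normR_ge0. Qed.

Lemma sqsum_nd x : {homo sqsum x : m n / (m <= n)%N >-> m <= n}.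
Proof.
move=> m n mn; rewrite /sqsum -(subnK mn) addnC big_split_ord/= lerDl.
by apply: sumr_ge0 => i _; rewrite exprn_ge0// normR_ge0.
Qed.

Definition square_summable : {pred nat -> R[i]} :=
  fun x => `[< exists C, forall n, sqsum x n <= C >].

Lemma square_summableP x :
  reflect (exists C, forall n, sqsum x n <= C) (x \in square_summable).
Proof. exact: asboolP. Qed.

Lemma normR_sqrD (z w : R[i]) :
  normR (z + w) ^+ 2 <= 2 * normR z ^+ 2 + 2 * normR w ^+ 2.
Proof.
have h := normRD z w; have h0 := normR_ge0 (z + w).
have hz := normR_ge0 z; have hw := normR_ge0 w.
have : normR (z + w) ^+ 2 <= (normR z + normR w) ^+ 2 by rewrite lerXn2r// nnegrE addr_ge0.
move=> /le_trans; apply.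
by have := sqr_ge0 (normR z - normR w); nra.
Qed.

Lemma square_summable_submod : submod_closed square_summable.
Proof.
split.
  apply/square_summableP; exists 0 => n; rewrite /sqsum big1// => i _.
  by rewrite normR0 expr0n.
move=> a x y /square_summableP[C hx] /square_summableP[D hy].
apply/square_summableP; exists (2 * normR a ^+ 2 * C + 2 * D) => n.
apply: (@le_trans _ _ (2 * normR a ^+ 2 * sqsum x n + 2 * sqsum y n)).
  rewrite /sqsum !mulr_sumr -big_split/=; apply: ler_sum => i _.
  by rewrite (le_trans (normR_sqrD _ _))// normRM exprMn mulrA.
by rewrite lerD// ler_wpM2l// mulr_ge0// sqr_ge0.
Qed.

HB.instance Definition _ := GRing.isSubmodClosed.Build R[i] (nat -> R[i])
  square_summable square_summable_submod.

Record l2 := L2 { l2seq :> nat -> R[i]; l2seqP : l2seq \in square_summable }.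

HB.instance Definition _ := [isSub for l2seq].
HB.instance Definition _ := gen_eqMixin l2.
HB.instance Definition _ := gen_choiceMixin l2.
HB.instance Definition _ := [SubChoice_isSubLmodule of l2 by <:].
End SquareSummable.

Lemma sum_cauchy_schwarz (R : realFieldType) (I : Type) (r : seq I) (P : pred I)
    (a b : I -> R) :
  (\sum_(i <- r | P i) a i * b i) ^+ 2 <=
  (\sum_(i <- r | P i) a i ^+ 2) * (\sum_(i <- r | P i) b i ^+ 2).
Proof.
set A := \sum_(i <- r | P i) a i ^+ 2; set C := \sum_(i <- r | P i) b i ^+ 2.
set B := \sum_(i <- r | P i) a i * b i.
have A0 : 0 <= A by apply: sumr_ge0 => i _; exact: sqr_ge0.
have C0 : 0 <= C by apply: sumr_ge0 => i _; exact: sqr_ge0.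
have key (s t : R) : 0 <= s ^+ 2 * A - 2 * s * t * B + t ^+ 2 * C.
  have : 0 <= \sum_(i <- r | P i) (s * a i - t * b i) ^+ 2.
    by apply: sumr_ge0 => i _; exact: sqr_ge0.
  rewrite (eq_bigr (fun i => s ^+ 2 * a i ^+ 2 + (- (2 * s * t)) * (a i * b i)
     + t ^+ 2 * b i ^+ 2)); last by move=> i _; ring.
  by rewrite 2!big_split/= -3!mulr_sumr -/A -/B -/C mulNr.
move: C0; rewrite le_eqVlt => /orP[/eqP C0|C0].
  (* if the second factor vanishes, a large multiple of b forces B = 0 *)
  rewrite -C0 mulr0; have [->|B0] := eqVneq B 0; first by rewrite expr0n.
  have := key 1 ((A + 1) / B); rewrite -C0 mulr0 addr0 expr1n mul1r.
  have -> : 2 * 1 * ((A + 1) / B) * B = 2 * (A + 1) by field.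
  lra.
have := key C B; have -> : C ^+ 2 * A - 2 * C * B * B + B ^+ 2 * C
   = C * (A * C - B ^+ 2) by ring.
by rewrite pmulr_rge0// subr_ge0.
Qed.

(** * Norm and completeness of the sequence space *)

Section L2Norm.
Variable R : realType.
Implicit Types (x y : l2 R) (a : R[i]).

Lemma l2D x y i : (x + y) i = x i + y i. Proof. by []. Qed.
Lemma l2N x i : (- x) i = - x i. Proof. by []. Qed.
Lemma l2Z a x i : (a *: x) i = a * x i. Proof. by []. Qed.

Lemma l2P x y : (forall i, x i = y i) -> x = y.
Proof. by move=> h; apply/val_inj/funext. Qed.

Lemma cvg_sqsum x : cvgn (sqsum x).
Proof.
apply: nondecreasing_is_cvgn; first by move=> m n; exact: sqsum_nd.
have /square_summableP[C hC] := l2seqP x.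
by exists C => _ [n _ <-]; exact: hC.
Qed.

Definition sqnorm x : R := limn (sqsum x).

Lemma sqsum_le_sqnorm x n : sqsum x n <= sqnorm x.
Proof. by apply: nondecreasing_cvgn_le => [m k|]; [exact: sqsum_nd|exact: cvg_sqsum]. Qed.

Lemma sqnorm_le x C : (forall n, sqsum x n <= C) -> sqnorm x <= C.
Proof. by move=> h; apply: limr_le; [exact: cvg_sqsum|exact: nearW]. Qed.

Lemma sqnorm_ge0 x : 0 <= sqnorm x.
Proof. exact: le_trans (sqsum_ge0 x 0) (sqsum_le_sqnorm x 0). Qed.

Definition l2norm x : R := Num.sqrt (sqnorm x).

Lemma l2norm_le x (r : R) : 0 <= r ->
  (forall n, sqsum x n <= r ^+ 2) -> l2norm x <= r.
Proof.
move=> r0 h; rewrite -(ger0_norm r0) -sqrtr_sqr; apply: ler_wsqrtr.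
exact: sqnorm_le.
Qed.

Lemma sqsum_le_l2norm x n : sqsum x n <= l2norm x ^+ 2.
Proof. by rewrite sqr_sqrtr ?sqnorm_ge0// sqsum_le_sqnorm. Qed.

Lemma coord_le_l2norm x i : normR (x i) <= l2norm x.
Proof.
rewrite -(ler_sqr (normR_ge0 _)) ?nnegrE ?sqrtr_ge0//.
apply: le_trans (sqsum_le_l2norm x i.+1).
by rewrite /sqsum big_ord_recr/= lerDr sumr_ge0// => j _; rewrite sqr_ge0.
Qed.

(** Minkowski's inequality for partial sums. *)
Lemma sqsumD (u v : nat -> R[i]) (r s : R) n : 0 <= r -> 0 <= s ->
  sqsum u n <= r ^+ 2 -> sqsum v n <= s ^+ 2 ->
  sqsum (fun i => u i + v i) n <= (r + s) ^+ 2.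
Proof.
move=> r0 s0 hu hv.
have cs := sum_cauchy_schwarz (index_enum 'I_n) xpredT
  (fun i => normR (u i)) (fun i => normR (v i)).
set B := \sum_(i < n) _ in cs.
have B0 : 0 <= B by apply: sumr_ge0 => i _; rewrite mulr_ge0// normR_ge0.
have Brs : B <= r * s.
  rewrite -(ler_sqr B0) ?nnegrE ?mulr_ge0// exprMn (le_trans cs)//.
  by rewrite ler_pM// sqsum_ge0.
apply: (@le_trans _ _ (sqsum u n + 2 * B + sqsum v n)); last by nra.
rewrite /sqsum /B mulr_sumr -!big_split/=; apply: ler_sum => i _.
have h := normRD (u i) (v i); have h0 := normR_ge0 (u i + v i).
have hz := normR_ge0 (u i); have hw := normR_ge0 (v i).
by nra.
Qed.

Lemma l2normD x y : l2norm (x + y) <= l2norm x + l2norm y.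
Proof.
apply: l2norm_le => [|n]; first by rewrite addr_ge0 ?sqrtr_ge0.
by apply: (@sqsumD x y); rewrite ?sqrtr_ge0 ?sqsum_le_l2norm.
Qed.

Lemma l2normZ a x : l2norm (a *: x) = normR a * l2norm x.
Proof.
have -> : normR a = Num.sqrt (normR a ^+ 2) by rewrite sqrtr_sqr ger0_norm ?normR_ge0.
rewrite -sqrtrM ?sqr_ge0//.
congr (Num.sqrt _).
have e : sqsum (a *: x) = (fun n => normR a ^+ 2 * sqsum x n).
  apply/funext => n; rewrite /sqsum mulr_sumr; apply: eq_bigr => i _.
  by rewrite l2Z normRM exprMn.
apply/cvg_lim => //; rewrite e.
by apply: cvgM; [exact: cvg_cst|exact: cvg_sqsum].
Qed.

Lemma l2norm_eq0 x : l2norm x = 0 -> x = 0.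
Proof.
move=> x0; apply: l2P => i; apply: normR_eq0; apply/eqP.
by rewrite eq_le normR_ge0 andbT -x0 coord_le_l2norm.
Qed.

Let cnorm x : R[i] := (l2norm x)%:C.

Let cnormD x y : cnorm (x + y) <= cnorm x + cnorm y.
Proof. by rewrite -rmorphD/= lecR l2normD. Qed.

Let cnormZ a x : cnorm (a *: x) = `|a| * cnorm x.
Proof. by rewrite /cnorm l2normZ rmorphM/= normRE. Qed.

Let cnorm_eq0 x : cnorm x = 0 -> x = 0.
Proof. by move=> /complexI; exact: l2norm_eq0. Qed.

HB.instance Definition _ := @Lmodule_isNormed.Build R[i] (l2 R) cnorm
  cnormD cnormZ cnorm_eq0.

Lemma normR_l2 x : normR x = l2norm x. Proof. by []. Qed.

(** The coordinatewise limit z of a Cauchy filter is its limit: if a ball around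
    y0 belongs to the filter, then every partial sum of |z - y0|^2 is bounded by
    comparing z with some y in that ball which is close to z on finitely many
    coordinates. *)
Lemma l2_complete (F : set_system (l2 R)) : ProperFilter F -> cauchy F -> cvg F.
Proof.
move=> FF Fc.
have Fball (e : R) : 0 < e -> exists y0, F [set y | l2norm (y0 - y) < e].
  move=> e0; have e0c : 0 < e%:C by rewrite ltcR.
  have [y0 hy0] := (cauchyP F).1 Fc _ e0c.
  exists y0; apply: filterS hy0 => y.
  by rewrite -ball_normE/= -normRE ltcR.
have coordC (f : l2 R -> R) :
  (forall x y, `|f x - f y| <= l2norm (x - y)) -> cvg (f @ F).
  move=> fl; apply: cauchy_cvg; apply: cauchy_exP => e e0.
  have [y0 hy0] := Fball _ e0; exists (f y0).
  rewrite /fmap/=; apply: filterS hy0 => y/=; rewrite -ball_normE/=.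
  exact: le_lt_trans (fl _ _).
have ReC i : cvg ((fun x : l2 R => complex.Re (x i)) @ F).
  apply: coordC => x y; apply: le_trans (coord_le_l2norm (x - y) i).
  have -> : complex.Re (x i) - complex.Re (y i) = complex.Re ((x - y) i).
    by rewrite l2D l2N; case: (x i) => ? ?; case: (y i).
  exact: absRe_le_normR.
have ImC i : cvg ((fun x : l2 R => complex.Im (x i)) @ F).
  apply: coordC => x y; apply: le_trans (coord_le_l2norm (x - y) i).
  have -> : complex.Im (x i) - complex.Im (y i) = complex.Im ((x - y) i).
    by rewrite l2D l2N; case: (x i) => ? ?; case: (y i).
  exact: absIm_le_normR.
pose z i : R[i] := lim ((fun x : l2 R => complex.Re (x i)) @ F)
  +i* lim ((fun x : l2 R => complex.Im (x i)) @ F).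
have zC i (e : R) : 0 < e -> F [set y | normR (z i - y i) < e].
  move=> e0; have e20 : 0 < e / 2 by rewrite divr_gt0.
  have /cvgrPdist_lt/(_ _ e20) h1 := ReC i.
  have /cvgrPdist_lt/(_ _ e20) h2 := ImC i.
  apply: filterS2 h1 h2 => y h1 h2 /=.
  apply: le_lt_trans (normR_le_ReIm _) _.
  move: h1 h2; rewrite /z; case: (y i) => a b/= h1 h2.
  by rewrite (splitr e) ltrD.
have sumC n (e : R) : 0 < e -> F [set y | sqsum (fun i => z i - y i) n < e].
  elim: n e => [|n IH] e e0.
    by apply: filterS filterT => y _ /=; rewrite /sqsum big_ord0.
  have e20 : 0 < e / 2 by rewrite divr_gt0.
  have h1 := IH _ e20; have h2 := @zC n (Num.sqrt (e / 2)).
  have /h2 : 0 < Num.sqrt (e / 2) by rewrite sqrtr_gt0.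
  apply: filterS2 h1 => y /= h1 {}h2.
  rewrite /sqsum big_ord_recr/= (splitr e) ltrD//.
  rewrite -[X in _ < X]sqr_sqrtr ?ltW// ltr_pXn2r// nnegrE ?normR_ge0 ?sqrtr_ge0//.
have zdist (e : R) y0 : 0 < e -> F [set y | l2norm (y0 - y) < e] ->
    forall n, sqsum (fun i => z i - y0 i) n <= (e + e) ^+ 2.
  move=> e0 hF n; have h := sumC n (e ^+ 2) (exprn_gt0 _ e0).
  have [y [/= h1 h2]] := filter_ex (filterI h hF).
  have -> : (fun i => z i - y0 i) = (fun i => (z i - y i) + (y i - y0 i)).
    by apply/funext => i; rewrite addrA subrK.
  apply: sqsumD; [exact: ltW|exact: ltW|exact: ltW|].
  have -> : sqsum (fun i => y i - y0 i) n = sqsum (y0 - y) n.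
    by apply: eq_bigr => i _; rewrite -normRN opprB.
  apply: le_trans (sqsum_le_l2norm _ _) _.
  by rewrite ltW// ltr_pXn2r// nnegrE ?sqrtr_ge0// ltW.
have [y1 hy1] := Fball 1 ltr01.
have zl2 : z \in @square_summable R.
  apply/square_summableP; exists ((1 + 1 + l2norm y1) ^+ 2) => n.
  have -> : z = (fun i => (z i - y1 i) + y1 i).
    by apply/funext => i; rewrite subrK.
  apply: sqsumD => //; first by rewrite sqrtr_ge0.
    exact: zdist.
  exact: sqsum_le_l2norm.
apply/cvg_ex; exists (L2 zl2); apply/cvgrPdist_lt => e.
rewrite ltcE/= => /andP[/eqP ei er].
pose d := complex.Re e / 4; have d0 : 0 < d by apply: divr_gt0; [exact: er|rewrite ltr0n].
have [y0 hy0] := Fball d d0; apply: filterS (hy0) => y /= hy.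
rewrite -normRE ltcE/= ei eqxx/= normR_l2.
have -> : L2 zl2 - y = (L2 zl2 - y0) + (y0 - y) by rewrite addrA subrK.
apply: le_lt_trans (l2normD _ _) _.
have hz : l2norm (L2 zl2 - y0) <= d + d.
  by apply: l2norm_le => [|n]; [exact: ltW (addr_gt0 d0 d0)|exact: zdist d0 hy0 n].
move: hy hz; rewrite /d; lra.
Qed.

HB.instance Definition _ := Uniform_isComplete.Build (l2 R) l2_complete.
End L2Norm.

(** * The inner product *)

Section L2Inner.
Variable R : realType.
Implicit Types (x y : l2 R) (a : R[i]).

Definition inner_sum x y n : R[i] := \sum_(i < n) x i * Num.conj (y i).

Lemma cvg_re_inner x y : cvgn (fun n => complex.Re (inner_sum x y n)).
Proof.
(* polarization: 2 Re <x, y> = |x + y|^2 - |x|^2 - |y|^2 *)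
have -> : (fun n => complex.Re (inner_sum x y n)) =
    (fun n => 2^-1 * (sqsum (x + y) n - sqsum x n - sqsum y n)).
  apply/funext => n; elim: n => [|n IH].
    by rewrite /inner_sum /sqsum !big_ord0/= subrr sub0r oppr0 mulr0.
  rewrite /inner_sum big_ord_recr/= -/(inner_sum x y n).
  rewrite ReD IH.
  rewrite /sqsum !big_ord_recr/= !normR_sqr ReD ImD.
  case: (x n) => a b; case: (y n) => c d /=; rewrite mulrN opprK; lra.
by apply: is_cvgMr; apply: is_cvgB; [apply: is_cvgB|]; exact: cvg_sqsum.
Qed.

Lemma inner_sumZr a x y n :
  inner_sum x (a *: y) n = Num.conj a * inner_sum x y n.
Proof.
rewrite /inner_sum mulr_sumr; apply: eq_bigr => i _.
by rewrite l2Z rmorphM/= mulrCA.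
Qed.

Lemma cvg_im_inner x y : cvgn (fun n => complex.Im (inner_sum x y n)).
Proof.
have -> : (fun n => complex.Im (inner_sum x y n)) =
    (fun n => complex.Re (inner_sum x ('i%C *: y) n)).
  apply/funext => n; rewrite inner_sumZr; case: (inner_sum x y n) => c d/=.
  by rewrite mul0r sub0r mulNr mul1r opprK.
exact: cvg_re_inner.
Qed.

(** The limit is taken separately in the real and imaginary parts, so that only
    convergence of real sequences is involved. *)
Definition l2inner x y : R[i] :=
  limn (fun n => complex.Re (inner_sum x y n)) +i*
  limn (fun n => complex.Im (inner_sum x y n)).

Lemma inner_sumDl x y z n :
  inner_sum (x + y) z n = inner_sum x z n + inner_sum y z n.
Proof. by rewrite -big_split; apply: eq_bigr => i _; rewrite l2D mulrDl. Qed.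

Lemma inner_sumZl a x y n : inner_sum (a *: x) y n = a * inner_sum x y n.
Proof. by rewrite mulr_sumr; apply: eq_bigr => i _; rewrite l2Z mulrA. Qed.

Lemma inner_sumC x y n : inner_sum x y n = Num.conj (inner_sum y x n).
Proof.
rewrite rmorph_sum; apply: eq_bigr => i _.
by rewrite rmorphM/= conjCK mulrC.
Qed.

Lemma l2innerC x y : l2inner x y = Num.conj (l2inner y x).
Proof.
rewrite /l2inner /=; congr (_ +i* _).
  by congr (limn _); apply/funext => n; rewrite inner_sumC; case: inner_sum.
have e : (fun n => complex.Im (inner_sum x y n)) =
    (fun n => - complex.Im (inner_sum y x n)).
  by apply/funext => n; rewrite inner_sumC; case: inner_sum.
by apply/cvg_lim => //; rewrite e; apply: cvgN; exact: cvg_im_inner.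
Qed.

Lemma l2innerDl x y z : l2inner (x + y) z = l2inner x z + l2inner y z.
Proof.
rewrite /l2inner /=; congr (_ +i* _); apply/cvg_lim => //.
  have -> : (fun n => complex.Re (inner_sum (x + y) z n)) =
      (fun n => complex.Re (inner_sum x z n) + complex.Re (inner_sum y z n)).
    by apply/funext => n; rewrite inner_sumDl ReD.
  by apply: cvgD; exact: cvg_re_inner.
have -> : (fun n => complex.Im (inner_sum (x + y) z n)) =
    (fun n => complex.Im (inner_sum x z n) + complex.Im (inner_sum y z n)).
  by apply/funext => n; rewrite inner_sumDl ImD.
by apply: cvgD; exact: cvg_im_inner.
Qed.

Lemma l2innerZl a x y : l2inner (a *: x) y = a * l2inner x y.
Proof.
have hr := @cvg_re_inner x y; have hi := @cvg_im_inner x y.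
rewrite /l2inner; case: a => a b /=; congr (_ +i* _); apply/cvg_lim => //.
  have -> : (fun n => complex.Re (inner_sum ((a +i* b) *: x) y n)) =
    (fun n => a * complex.Re (inner_sum x y n) - b * complex.Im (inner_sum x y n)).
    by apply/funext => n; rewrite inner_sumZl; case: inner_sum.
  by apply: cvgB; apply: cvgM => //; exact: cvg_cst.
have -> : (fun n => complex.Im (inner_sum ((a +i* b) *: x) y n)) =
    (fun n => a * complex.Im (inner_sum x y n) + b * complex.Re (inner_sum x y n)).
  by apply/funext => n; rewrite inner_sumZl; case: inner_sum.
by apply: cvgD; apply: cvgM => //; exact: cvg_cst.
Qed.

Lemma l2inner_norm x : l2inner x x = `|x| ^+ 2.
Proof.
rewrite -normRE normR_l2 -rmorphXn/= sqr_sqrtr ?sqnorm_ge0// /l2inner.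
have e n : inner_sum x x n = (sqsum x n)%:C.
  rewrite /inner_sum /sqsum rmorph_sum/=; apply: eq_bigr => i _.
  by rewrite -normCK rmorphXn/= normRE.
congr (_ +i* _); first by congr (limn _); apply/funext => n; rewrite e.
by rewrite (_ : (fun _ => _) = cst 0) ?lim_cst//; apply/funext => n; rewrite e.
Qed.

Lemma l2inner_bilinear :
  bilinear_for *%R (Num.conj \; *%R : R[i] -> R[i] -> R[i]) l2inner.
Proof.
split=> [z a x y|z a x y] /=; first by rewrite l2innerDl l2innerZl.
rewrite l2innerC l2innerDl l2innerZl rmorphD rmorphM/=.
by rewrite -!(l2innerC z).
Qed.

HB.instance Definition _ := bilinear_isBilinear.Build R[i] (l2 R) (l2 R) R[i]
  *%R (Num.conj \; *%R) l2inner l2inner_bilinear.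

Lemma l2inner_hermitian x y :
  l2inner x y = (-1) ^+ false * Num.conj (l2inner y x).
Proof. by rewrite expr0 mul1r; exact: l2innerC. Qed.

HB.instance Definition _ := isHermitianSesquilinear.Build R[i] (l2 R) false
  (@Num.conj R[i]) l2inner l2inner_hermitian.

Lemma l2inner_gt0 x : x != 0 -> 0 < l2inner x x.
Proof. by move=> x0; rewrite l2inner_norm exprn_gt0// normr_gt0. Qed.

HB.instance Definition _ := isDotProduct.Build R[i] (l2 R) l2inner l2inner_gt0.

HB.instance Definition _ := CompleteNormedModule_isHilbert.Build R (l2 R)
  l2inner_norm.

End L2Inner.

(** * Coefficients of the powers of 1 - z *)

Section BinomialSeries.
Variable R : realFieldType.
Implicit Types (c : R) (n : nat).

(** The coefficient of z^n in the power series of (1 - z)^-c. *)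
Definition npow c n : R := \prod_(k < n) ((c + k%:R) / k.+1%:R).

Lemma npow0 c : npow c 0 = 1.
Proof. by rewrite /npow big_ord0. Qed.

Lemma npowS c n : npow c n.+1 = npow c n * ((c + n%:R) / n.+1%:R).
Proof. by rewrite /npow big_ord_recr. Qed.

Let natS_neq0 n : n.+1%:R != 0 :> R. Proof. by rewrite pnatr_eq0. Qed.

Lemma npowS_mul c n : n.+1%:R * npow c n.+1 = (c + n%:R) * npow c n.
Proof. by rewrite npowS mulrCA mulrC; field; rewrite nat1r natS_neq0. Qed.

Lemma npow_shift c n : npow c n.+1 = c / n.+1%:R * npow (1 + c) n.
Proof.
elim: n => [|n IH]; first by rewrite npowS !npow0; field.
rewrite npowS IH [npow (1 + c) n.+1]npowS -!nat1r; field.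
by rewrite !nat1r !natS_neq0.
Qed.

Lemma npow_gt0 c n : 0 < c -> 0 < npow c n.
Proof.
move=> c0; apply: prodr_gt0 => k _.
by rewrite divr_gt0// ltr_wpDr.
Qed.

Lemma npow_sum c n : \sum_(k < n.+1) npow c k = npow (1 + c) n.
Proof.
elim: n => [|n IH]; first by rewrite big_ord_recr big_ord0 /= add0r !npow0.
rewrite big_ord_recr /= IH npow_shift [RHS]npowS -!nat1r; field.
by rewrite nat1r natS_neq0.
Qed.

(** The power series of (1 - z)^-c and (1 - z)^c are inverse to each other.
    Their product d has zero derivative, which on coefficients reads
    (n + 1) d_{n+1} = n d_n. *)
Lemma npow_conv c n :
  \sum_(i < n.+1) npow c i * npow (- c) (n - i) = (n == 0)%:R.
Proof.
pose d n := \sum_(i < n.+1) npow c i * npow (- c) (n - i).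
have rec m : m.+1%:R * d m.+1 = m%:R * d m.
  rewrite /d mulr_sumr.
  transitivity (\sum_(i < m.+2) i%:R * npow c i * npow (- c) (m.+1 - i) +
     \sum_(i < m.+2) npow c i * ((m.+1 - i)%:R * npow (- c) (m.+1 - i))).
    rewrite -big_split; apply: eq_bigr => i _ /=.
    by rewrite -{1}(subnKC (leq_ord i)) natrD; ring.
  rewrite big_ord_recl/= !mul0r add0r [X in _ + X]big_ord_recr/= subnn mul0r mulr0 addr0.
  rewrite -big_split mulr_sumr; apply: eq_bigr => i _ /=.
  rewrite /bump leq0n add1n subSS subSn ?leq_ord// !npowS_mul.
  have -> : (m%:R : R) = i%:R + (m - i)%:R by rewrite -natrD subnKC ?leq_ord.
  ring.
rewrite -/(d n); elim: n => [|n IH]; first by rewrite /d big_ord_recr big_ord0 /= add0r !npow0 mulr1.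
apply: (mulfI (natS_neq0 n)); rewrite rec IH mulr0.
by case: n {IH} => [|n]; rewrite ?mul0r ?mulr0.
Qed.

(** Let S be the convolution by the coefficients of (1 - z)^-c, seen as a lower
    triangular matrix, and P_k the projection onto the first k coordinates. This
    is the closed form of the entry of S P_k S^-1 in row k + v and column
    k - 1 - u. It is asymptotic to a multiple of (v / u)^c / (u + v), a kernel
    of Hardy type which is homogeneous of degree -1, hence bounded on l2 for
    c < 1/2. *)
Definition proj_kernel c (u v : nat) : R :=
  c * npow (1 + c) v * npow (1 - c) u / (u + v).+1%:R.

Lemma proj_kernel0 c u : proj_kernel c u 0 = - npow (- c) u.+1.
Proof. by rewrite /proj_kernel npow_shift npow0 addn0; ring. Qed.

(** Splitting off the term s = 0 of the convolution in [proj_kernelE] and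
    shifting the others gives this recurrence. *)
Lemma proj_kernel_rec c u v :
  proj_kernel c u v.+1 =
  npow c v.+1 * proj_kernel c u 0 + proj_kernel c u.+1 v.
Proof.
rewrite proj_kernel0 npow_shift (npow_shift (- c)) /proj_kernel !npowS.
rewrite addnS addSn -!nat1r !natrD; field.
have : 1 + (1 + (u%:R + v%:R)) != 0 :> R by rewrite -natrD !nat1r.
have : 1 + u%:R != 0 :> R by rewrite nat1r.
have : 1 + v%:R != 0 :> R by rewrite nat1r.
by move=> -> -> ->.
Qed.

Lemma proj_kernelE c u v :
  proj_kernel c u v = \sum_(s < v.+1) npow c (v - s) * - npow (- c) (u + s).+1.
Proof.
elim: v u => [|v IH] u.
  by rewrite big_ord_recr big_ord0 /= npow0 add0r mul1r addn0 proj_kernel0.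
rewrite proj_kernel_rec IH [RHS]big_ord_recl/= subn0 addn0 proj_kernel0; congr (_ + _).
by apply: eq_bigr => s _; rewrite /bump leq0n add1n subSS addnS addSn.
Qed.

Lemma npow_fall_telescope c n :
  \sum_(u < n) proj_kernel c u 0 = 1 - npow (1 - c) n.
Proof.
elim: n => [|n IH]; first by rewrite big_ord0 npow0 subrr.
rewrite big_ord_recr/= IH /proj_kernel npow0 addn0 npowS -nat1r; field.
by rewrite nat1r.
Qed.

Lemma proj_kernel_ge0 c u v : 0 < c < 1 -> 0 <= proj_kernel c u v.
Proof.
move=> /andP[c0 c1]; rewrite /proj_kernel divr_ge0// mulr_ge0//; last first.
  by rewrite ltW// npow_gt0// subr_gt0.
by rewrite mulr_ge0 ?ltW// npow_gt0// addr_gt0.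
Qed.

(** The infinite sum over u equals 1 because (1 - z)^(c - 1), the generating
    function of the tails of 1 - (1 - z)^c, multiplied by (1 - z)^-c gives
    (1 - z)^-1. With finitely many terms, the recurrence yields an inequality by
    induction on v. *)
Lemma proj_kernel_sum_le1 c v n : 0 < c < 1 ->
  \sum_(u < n) proj_kernel c u v <= 1.
Proof.
move=> c01; have /andP[c0 c1] := c01; elim: v n => [|v IH] n.
  by rewrite npow_fall_telescope gerBl ltW// npow_gt0// subr_gt0.
under eq_bigr do rewrite proj_kernel_rec; rewrite big_split/= -mulr_sumr.
have b0 := npow_gt0 v.+1 c0.
have hs := IH n.+1; rewrite big_ord_recl in hs.
have e0 : proj_kernel c 0 v = npow c v.+1.
  by rewrite /proj_kernel npow0 npow_shift add0n; ring.
move: hs; rewrite /= e0 npow_fall_telescope => hs.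
have : npow c v.+1 * (1 - npow (1 - c) n) <= npow c v.+1.
  by rewrite ler_piMr ?(ltW b0)// gerBl ltW// npow_gt0// subr_gt0.
move: hs; rewrite (eq_bigr (fun i : 'I_n => proj_kernel c i.+1 v)) => [|i _]; last first.
  by rewrite /bump leq0n add1n.
lra.
Qed.

Lemma npow_rise_fall_le1 c n : 0 < c < 1 ->
  npow (1 + c) n * npow (1 - c) n <= 1.
Proof.
move=> /andP[c0 c1]; rewrite /npow -big_split/=; apply: prodr_ile1 => k _.
rewrite -!nat1r mulf_div; apply/andP; split.
  by rewrite divr_ge0// mulr_ge0//; have := ler0n R k; lra.
rewrite ler_pdivrMr ?mulr_gt0// ?nat1r// mul1r -!nat1r.
by have := ler0n R k; nra.
Qed.

Lemma npow_noninc c n : 0 < c < 1 -> npow c n.+1 <= npow c n.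
Proof.
move=> /andP[c0 c1]; rewrite npowS; apply: ler_piMr; first exact/ltW/npow_gt0.
by rewrite ler_pdivrMr// mul1r -nat1r lerD2r ltW.
Qed.

End BinomialSeries.

Section Powers.
Variable R : realType.
Implicit Types (c : R) (n : nat).

(** Bernoulli's inequality with exponent at most 1, as a case of Young's
    inequality for the conjugate exponents 1/c and 1/(1 - c). *)
Lemma powR_bernoulli c (x : R) : 0 < c < 1 -> 0 <= x -> x `^ c <= 1 + c * (x - 1).
Proof.
move=> /andP[c0 c1] x0; have d0 : 0 < 1 - c by rewrite subr_gt0.
have := @conjugate_powR R (x `^ c) 1 c^-1 (1 - c)^-1 (powR_ge0 _ _) ler01.
rewrite !invr_gt0 !invrK mulr1 powR1 -powRrM mulfV ?gt_eqF// powRr1// => /(_ c0 d0).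
by rewrite addrC subrK => /(_ erefl); lra.
Qed.

(** Each factor satisfies (1 + 1/k)^c <= 1 + c/k by Bernoulli's inequality, and
    the left-hand sides telescope. *)
Lemma npow_rise_ge c n : 0 < c < 1 -> n.+1%:R `^ c <= npow (1 + c) n.
Proof.
move=> c01; have /andP[c0 c1] := c01; elim: n => [|n IH]; first by rewrite npow0 powR1.
have -> : n.+2%:R = n.+1%:R * (n.+2%:R / n.+1%:R) :> R.
  by rewrite mulrC divfK// pnatr_eq0.
rewrite powRM// ?divr_ge0// npowS ler_pM ?powR_ge0//.
apply: (le_trans (powR_bernoulli c01 _)); first by rewrite divr_ge0.
rewrite le_eqVlt; apply/orP; left; apply/eqP.
by rewrite -!nat1r; field; rewrite nat1r pnatr_eq0.
Qed.

(** Here Bernoulli's inequality is (1 - 1/k)^c <= 1 - c/k for k >= 2; the first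
    factor 1 - c is kept apart since the bound degenerates for k = 1. *)
Lemma npow_fall_geS c n : 0 < c < 1 ->
  1 - c <= npow (1 - c) n.+1 * n.+1%:R `^ c.
Proof.
move=> c01; have /andP[c0 c1] := c01; elim: n => [|n IH].
  by rewrite npowS npow0 powR1 addr0 divr1 mul1r mulr1.
apply: le_trans IH _; rewrite [npow _ n.+2]npowS -mulrA ler_pM2l ?npow_gt0 ?subr_gt0//.
have e : n.+1%:R = n.+2%:R * (n.+1%:R / n.+2%:R) :> R.
  by rewrite mulrC divfK// pnatr_eq0.
rewrite {1}e powRM// ?divr_ge0// mulrC ler_wpM2r ?powR_ge0//.
apply: (le_trans (powR_bernoulli c01 _)); first by rewrite divr_ge0.
rewrite le_eqVlt; apply/orP; left; apply/eqP.
have h : 1 + (1 + n%:R) != 0 :> R by rewrite !nat1r pnatr_eq0.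
by rewrite -!nat1r; field.
Qed.

Lemma npow_fall_ge c n : 0 < c < 1 ->
  1 - c <= npow (1 - c) n * n.+1%:R `^ c.
Proof.
move=> c01; have /andP[c0 c1] := c01; case: n => [|n].
  by rewrite npow0 powR1 mulr1 lerBlDr lerDl ltW.
apply: le_trans (npow_fall_geS n c01) _.
rewrite ler_pM2l ?npow_gt0 ?subr_gt0//.
by apply: ge0_ler_powR; rewrite ?nnegrE ?ler_nat// ltW.
Qed.

Lemma npow_fall_le c n : 0 < c < 1 -> npow (1 - c) n * n.+1%:R `^ c <= 1.
Proof.
move=> c01; have /andP[c0 c1] := c01.
apply: le_trans (npow_rise_fall_le1 n c01); rewrite mulrC.
by rewrite ler_pM2r ?npow_gt0 ?subr_gt0// npow_rise_ge.
Qed.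

Lemma npow_rise_le c n : 0 < c < 1 -> (1 - c) * npow (1 + c) n <= n.+1%:R `^ c.
Proof.
move=> c01; have /andP[c0 c1] := c01.
have g0 : 0 < npow (1 + c) n by rewrite npow_gt0// addr_gt0.
have P0 : 0 < n.+1%:R `^ c by rewrite powR_gt0.
have h1 := npow_fall_ge n c01; have h2 := npow_rise_fall_le1 n c01.
apply: (@le_trans _ _ (npow (1 - c) n * n.+1%:R `^ c * npow (1 + c) n)).
  by rewrite ler_pM2r.
by rewrite mulrAC mulrC (mulrC (npow (1 - c) n)) ler_piMr// ltW.
Qed.

End Powers.

(** * Schur's test and the boundedness of the projection kernel *)

Ltac positivity := repeat first [assumption | apply: exprn_gt0 | apply: mulr_gt0
  | rewrite invr_gt0 | rewrite subr_gt0].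

Section Schur.
Variable R : rcfType.

Lemma sum_weighted_sqr (I : Type) (r : seq I) (P : pred I) (w y : I -> R) :
  (forall i, P i -> 0 <= w i) ->
  (\sum_(i <- r | P i) w i * y i) ^+ 2 <=
  (\sum_(i <- r | P i) w i) * \sum_(i <- r | P i) w i * y i ^+ 2.
Proof.
move=> w0.
have sw i : P i -> Num.sqrt (w i) ^+ 2 = w i by move=> Pi; rewrite sqr_sqrtr ?w0.
have -> : \sum_(i <- r | P i) w i * y i =
    \sum_(i <- r | P i) Num.sqrt (w i) * (Num.sqrt (w i) * y i).
  by apply: eq_bigr => i Pi; rewrite mulrA -expr2 sw.
have -> : \sum_(i <- r | P i) w i * y i ^+ 2 =
    \sum_(i <- r | P i) (Num.sqrt (w i) * y i) ^+ 2.
  by apply: eq_bigr => i Pi; rewrite exprMn sw.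
have -> : \sum_(i <- r | P i) w i = \sum_(i <- r | P i) Num.sqrt (w i) ^+ 2.
  by apply: eq_bigr => i Pi; rewrite sw.
exact: sum_cauchy_schwarz.
Qed.

Lemma schur_test (n m : nat) (M : nat -> nat -> R) (p q : nat -> R) (C D : R)
    (x : nat -> R) :
  (forall i j, 0 <= M i j) -> (forall j, 0 < p j) -> 0 <= C ->
  (forall i, \sum_(j < n) M i j * p j <= C * q i) ->
  (forall j, \sum_(i < m) M i j * q i <= D * p j) ->
  \sum_(i < m) (\sum_(j < n) M i j * x j) ^+ 2 <= C * D * \sum_(j < n) x j ^+ 2.
Proof.
move=> M0 p0 C0 hC hD.
have pn j : p j != 0 by rewrite gt_eqF.
apply: (@le_trans _ _
  (\sum_(i < m) C * q i * \sum_(j < n) M i j * (x j ^+ 2 / p j))).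
  apply: ler_sum => i _.
  have -> : \sum_(j < n) M i j * x j = \sum_(j < n) (M i j * p j) * (x j / p j).
    by apply: eq_bigr => j _; rewrite -mulrA (mulrC (p j)) divfK.
  have -> : \sum_(j < n) M i j * (x j ^+ 2 / p j) =
      \sum_(j < n) (M i j * p j) * (x j / p j) ^+ 2.
    by apply: eq_bigr => j _; field.
  have Mp0 j : 0 <= M i j * p j by rewrite mulr_ge0// ltW.
  apply: le_trans (sum_weighted_sqr _ _ _) _ => [j _|]; first exact: Mp0.
  by rewrite ler_wpM2r// sumr_ge0// => j _; rewrite mulr_ge0// sqr_ge0.
under eq_bigr do rewrite mulr_sumr.
rewrite exchange_big/= mulr_sumr; apply: ler_sum => j _.
rewrite (eq_bigr (fun i : 'I_m => C * (x j ^+ 2 / p j) * (M i j * q i))) => [|i _]; last by ring.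
rewrite -mulr_sumr; apply: (@le_trans _ _ (C * (x j ^+ 2 / p j) * (D * p j))).
  by rewrite ler_wpM2l// mulr_ge0// divr_ge0 ?sqr_ge0// ltW.
by rewrite le_eqVlt; apply/orP; left; apply/eqP; field.
Qed.
End Schur.

Lemma lt_half_unit (R : realFieldType) (a : R) : 0 < a < 2^-1 -> 0 < a < 1.
Proof. by move=> /andP[a0 ah]; apply/andP; split=> //; lra. Qed.

Section KernelBound.
Variable R : realType.
Variable al : R.
Hypothesis al01 : 0 < al < 2^-1.

Let al_gt0 : 0 < al. Proof. by case/andP: al01. Qed.
Let al_lt : al < 2^-1. Proof. by case/andP: al01. Qed.

Let al1 : 0 < al < 1. Proof. exact: lt_half_unit. Qed.
Let be := al + 2^-1.
Let ga := 2^-1 - al.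
Let be1 : 0 < be < 1.
Proof. by have := al_gt0; have := al_lt; rewrite /be => ? ?; apply/andP; split; lra. Qed.
Let ga1 : 0 < ga < 1.
Proof. by have := al_gt0; have := al_lt; rewrite /ga => ? ?; apply/andP; split; lra. Qed.

(** The kernel with exponent al behaves like (v / u)^al / (u + v), for which the
    weights u^(-1/2) and v^(-1/2) prove boundedness. Replacing these powers by
    quotients of the binomial coefficients with the same growth turns both sums
    in Schur's test into sums of the kernels with exponents al + 1/2 and
    1/2 - al, which [proj_kernel_sum_le1] evaluates. *)
Let row_weight (v : nat) := npow (1 + al) v / npow (1 + be) v.
Let col_weight (u : nat) := npow (1 - be) u / npow (1 - al) u.

Let rise_gt0 (c : R) n : 0 < c < 1 -> 0 < npow (1 + c) n.
Proof. by move=> /andP[c0 c1]; rewrite npow_gt0//; lra. Qed.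

Let fall_gt0 (c : R) n : 0 < c < 1 -> 0 < npow (1 - c) n.
Proof. by move=> /andP[c0 c1]; rewrite npow_gt0//; lra. Qed.

Let den_neq0 (u v : nat) : 1 + (u%:R + v%:R) != 0 :> R.
Proof. by rewrite -natrD nat1r pnatr_eq0. Qed.

Let row_sum v n :
  \sum_(u < n) proj_kernel al u v * col_weight u <= al / be * row_weight v.
Proof.
have /andP[be0 _] := be1.
rewrite (eq_bigr (fun u : 'I_n => al / be * row_weight v * proj_kernel be u v)).
  rewrite -mulr_sumr ler_piMr ?proj_kernel_sum_le1//.
  by apply: mulr_ge0; apply: divr_ge0; apply: ltW => //; exact: rise_gt0.
move=> u _; rewrite /proj_kernel /col_weight /row_weight.
have h1 := lt0r_neq0 (fall_gt0 u al1); have h2 := lt0r_neq0 (rise_gt0 v be1).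
have h3 := lt0r_neq0 be0; field.
by rewrite den_neq0 h1 h2 h3.
Qed.

Let row_weight_le v : row_weight v * npow (1 + al) v <=
  ((1 - al) ^+ 2 * (1 - ga))^-1 * npow (1 - ga) v.
Proof.
set t := v.+1%:R : R; have t0 : 0 < t by rewrite ltr0n.
have /andP[_ ga1'] := ga1; have /andP[_ al1'] := al1.
have hb := npow_rise_ge v be1; have ha := npow_rise_le v al1.
have hg := npow_fall_ge v ga1; rewrite -/t in hb ha hg.
have Pg : 0 < t `^ ga by rewrite powR_gt0.
have e : t `^ al * t `^ al * t `^ ga = t `^ be.
  have -> : be = al + al + ga by rewrite /be /ga; lra.
  by rewrite !powRD ?(gt_eqF t0) ?implybT.
have ga0 := rise_gt0 v al1; have gb0 := rise_gt0 v be1; have fg0 := fall_gt0 v ga1.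
rewrite /row_weight mulrAC ler_pdivrMr// -mulrA ler_pdivlMl; last first.
  by rewrite mulr_gt0 ?exprn_gt0// subr_gt0.
rewrite -(ler_pM2r Pg).
have -> : (1 - al) ^+ 2 * (1 - ga) * (npow (1 + al) v * npow (1 + al) v) * t `^ ga
  = (((1 - al) * npow (1 + al) v) * ((1 - al) * npow (1 + al) v) * t `^ ga) * (1 - ga) by ring.
have -> : npow (1 - ga) v * npow (1 + be) v * t `^ ga =
  npow (1 + be) v * (npow (1 - ga) v * t `^ ga) by ring.
have Pa : 0 <= (1 - al) * npow (1 + al) v by rewrite mulr_ge0 ?subr_ge0 ?ltW.
apply: ler_pM (hg) => //; [|by rewrite subr_ge0 ltW|].
  by rewrite mulr_ge0 ?(ltW Pg)// mulr_ge0.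
by apply: le_trans hb; rewrite -e ler_pM2r// ler_pM.
Qed.

Let fall_sqr_le u : npow (1 - al) u / npow (1 + ga) u <=
  (1 - be)^-1 * col_weight u.
Proof.
set t := u.+1%:R : R; have t0 : 0 < t by rewrite ltr0n.
have /andP[_ be1'] := be1.
have hb := npow_fall_ge u be1; have ha := npow_fall_le u al1.
have hg := npow_rise_ge u ga1; rewrite -/t in hb ha hg.
have e : t `^ al * t `^ al * t `^ ga = t `^ be.
  have -> : be = al + al + ga by rewrite /be /ga; lra.
  by rewrite !powRD ?(gt_eqF t0) ?implybT.
have fa := fall_gt0 u al1; have fb := fall_gt0 u be1; have gg := rise_gt0 u ga1.
have Pa : 0 < t `^ al by rewrite powR_gt0.
have Pg : 0 < t `^ ga by rewrite powR_gt0.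
rewrite /col_weight mulrA ler_pdivlMr// mulrAC ler_pdivrMr// -mulrA.
rewrite ler_pdivlMl ?subr_gt0//.
have f2 : 0 < npow (1 - al) u * npow (1 - al) u by rewrite mulr_gt0.
apply: (@le_trans _ _ ((npow (1 - be) u * t `^ be) * (npow (1 - al) u * npow (1 - al) u))).
  by rewrite ler_pM2r.
rewrite -e.
have -> : npow (1 - be) u * (t `^ al * t `^ al * t `^ ga) * (npow (1 - al) u * npow (1 - al) u)
  = npow (1 - be) u * (((npow (1 - al) u * t `^ al) * (npow (1 - al) u * t `^ al)) * t `^ ga).
  by ring.
rewrite ler_pM2l//; apply: le_trans hg.
have fa0 : 0 <= npow (1 - al) u * t `^ al by rewrite mulr_ge0// ltW.
by apply: ler_piMl; [exact: ltW|rewrite mulr_ile1].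
Qed.

Let col_sum : exists2 D, 0 < D &
  forall u m, \sum_(v < m) proj_kernel al u v * row_weight v <= D * col_weight u.
Proof.
pose C1 := ((1 - al) ^+ 2 * (1 - ga))^-1.
have /andP[ga0 ga1'] := ga1; have /andP[_ al1'] := al1; have /andP[_ be1'] := be1.
have C10 : 0 < C1 by rewrite invr_gt0 mulr_gt0 ?exprn_gt0 ?subr_gt0.
exists (al * C1 / ga / (1 - be)); first by positivity.
move=> u m; have fa := fall_gt0 u al1; have gg := rise_gt0 u ga1.
apply: (@le_trans _ _ (\sum_(v < m)
    al * C1 / ga * (npow (1 - al) u / npow (1 + ga) u) * proj_kernel ga v u)).
  apply: ler_sum => v _.
  have -> : proj_kernel al u v * row_weight v = al * npow (1 - al) u / (u + v).+1%:R *
     (row_weight v * npow (1 + al) v).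
    by rewrite /proj_kernel; field; rewrite den_neq0.
  have -> : al * C1 / ga * (npow (1 - al) u / npow (1 + ga) u) * proj_kernel ga v u =
     al * npow (1 - al) u / (u + v).+1%:R * (C1 * npow (1 - ga) v).
    rewrite /proj_kernel addnC; field.
    by rewrite den_neq0 (gt_eqF gg) (gt_eqF ga0).
  by rewrite ler_wpM2l ?row_weight_le// divr_ge0// mulr_ge0// ltW.
have h0 : 0 <= al * C1 / ga by apply: ltW; positivity.
rewrite -mulr_sumr -[X in _ <= X]mulrA.
apply: (@le_trans _ _ (al * C1 / ga * (npow (1 - al) u / npow (1 + ga) u))).
  rewrite ler_piMr ?proj_kernel_sum_le1//.
  by rewrite mulr_ge0// divr_ge0// ltW.
by rewrite ler_wpM2l// fall_sqr_le.
Qed.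

Lemma proj_kernel_bounded : exists2 C, 0 < C & forall n m (x : nat -> R),
  \sum_(v < m) (\sum_(u < n) proj_kernel al u v * x u) ^+ 2 <=
  C * \sum_(u < n) x u ^+ 2.
Proof.
have [D D0 hD] := col_sum; have /andP[be0 _] := be1.
exists (al / be * D); first by positivity.
move=> n m x; apply: (@schur_test _ n m (fun v u => proj_kernel al u v)
  col_weight row_weight) => [v u|u|||u].
- by rewrite proj_kernel_ge0.
- by rewrite divr_gt0 ?fall_gt0.
- by rewrite divr_ge0 ?ltW.
- by move=> v; exact: row_sum.
- exact: hD.
Qed.

(** The squares decay like n^(2 al - 2), which is also the decay of the
    coefficients of (1 - z)^(1 - 2 al); the latter are summable by telescoping. *)
Lemma npow_square_summable : exists2 B, 0 < B &
  forall n, \sum_(i < n) npow al i ^+ 2 <= B.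
Proof.
pose c := 1 - 2 * al.
have c1 : 0 < c < 1 by apply/andP; split; rewrite /c; have := al_gt0; have := al_lt; lra.
have /andP[c0 c1'] := c1; have /andP[_ al1'] := al1.
pose K := (al / (1 - al)) ^+ 2 / (c * (1 - c)).
have K0 : 0 < K by positivity.
exists (1 + K) => [|n]; first by rewrite addr_gt0.
have key i : npow al i.+1 ^+ 2 <= K * proj_kernel c i 0.
  rewrite npow_shift /proj_kernel npow0 addn0 mulr1.
  set t := i.+1%:R : R; have t0 : 0 < t by rewrite ltr0n.
  have ha := npow_rise_le i al1; have hc := npow_fall_ge i c1; rewrite -/t in ha hc.
  have gg := rise_gt0 i al1; have ff := fall_gt0 i c1.
  have Pa : 0 < t `^ al by rewrite powR_gt0.
  have Pc : 0 < t `^ c by rewrite powR_gt0.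
  have e : t `^ al * t `^ al * t `^ c = t.
    rewrite -!powRD ?(gt_eqF t0) ?implybT// (_ : al + al + c = 1) ?powRr1 ?ltW//.
    by rewrite /c; ring.
  have h : (1 - al) ^+ 2 * npow (1 + al) i ^+ 2 * (1 - c) <= t * npow (1 - c) i.
    apply: (@le_trans _ _ ((t `^ al * t `^ al) * (npow (1 - c) i * t `^ c))); last first.
      have -> : t `^ al * t `^ al * (npow (1 - c) i * t `^ c) =
        (t `^ al * t `^ al * t `^ c) * npow (1 - c) i by ring.
      by rewrite e.
    rewrite -exprMn expr2.
    have a0 : 0 <= (1 - al) * npow (1 + al) i by rewrite mulr_ge0 ?subr_ge0 ?ltW.
    apply: ler_pM (hc) => //; [by rewrite mulr_ge0|by rewrite subr_ge0 ltW|].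
    by rewrite ler_pM.
  have -> : (al / t * npow (1 + al) i) ^+ 2 =
     (al / (1 - al)) ^+ 2 / (1 - c) / t ^+ 2 *
     ((1 - al) ^+ 2 * npow (1 + al) i ^+ 2 * (1 - c)).
    by field; rewrite nat1r pnatr_eq0 !subr_eq0 (gt_eqF al1') (gt_eqF c1').
  have -> : K * (c * npow (1 - c) i / t) =
     (al / (1 - al)) ^+ 2 / (1 - c) / t ^+ 2 * (t * npow (1 - c) i).
    by rewrite /K; field; rewrite nat1r pnatr_eq0 (gt_eqF c0) !subr_eq0 (gt_eqF al1') (gt_eqF c1').
  by apply: ler_wpM2l h; apply: ltW; positivity.
case: n => [|n]; first by rewrite big_ord0 ltW// addr_gt0.
rewrite big_ord_recl/= npow0 expr1n lerD2l.
apply: (@le_trans _ _ (\sum_(i < n) K * proj_kernel c i 0)).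
  by apply: ler_sum => i _; rewrite /bump leq0n add1n.
by rewrite -mulr_sumr ler_piMr ?(ltW K0)// proj_kernel_sum_le1.
Qed.

End KernelBound.

(** * Diagonal operators in a conditional basis *)

Section Convolution.
Variable R : realType.
Implicit Types (b : nat -> R) (x y f g : nat -> R[i]) (c : R).

Definition seq_conv b x (i : nat) : R[i] := \sum_(k < i.+1) (b (i - k)%N)%:C * x k.

Lemma seq_convD b x y i : seq_conv b (fun k => x k + y k) i = seq_conv b x i + seq_conv b y i.
Proof. by rewrite -big_split; apply: eq_bigr => k _; rewrite mulrDr. Qed.

Lemma seq_convZ b (a : R[i]) x i : seq_conv b (fun k => a * x k) i = a * seq_conv b x i.
Proof. by rewrite mulr_sumr; apply: eq_bigr => k _; rewrite mulrCA. Qed.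

Lemma eq_seq_conv b x y i : (forall k, (k <= i)%N -> x k = y k) ->
  seq_conv b x i = seq_conv b y i.
Proof. by move=> h; apply: eq_bigr => k _; rewrite h ?leq_ord. Qed.

Lemma npow_conv_nat c (i j : nat) : (j <= i)%N ->
  \sum_(j <= l < i.+1) npow c (i - l) * npow (- c) (l - j) = (i == j)%:R.
Proof.
move=> ji; rewrite -{1}(add0n j) big_addn subSn// big_mkord.
have -> : (i == j) = ((i - j)%N == 0)%N by lia.
rewrite -(npow_conv (- c)) opprK; apply: eq_bigr => l _.
by rewrite mulrC addnK addnC subnDA.
Qed.

(** Convolution is multiplication of power series; truncating them to
    polynomials makes associativity available. *)
Lemma npow_convK c x i : seq_conv (npow c) (seq_conv (npow (- c)) x) i = x i.
Proof.
pose A := \poly_(k < i.+1) ((npow (- c) k)%:C : R[i]).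
pose B := \poly_(k < i.+1) ((npow c k)%:C : R[i]).
pose X := \poly_(k < i.+1) (x k).
transitivity ((X * A * B)`_i).
  rewrite coefM; apply: eq_bigr => k _; rewrite mulrC; congr (_ * _).
    rewrite coefM; apply: eq_bigr => j _; rewrite mulrC !coef_poly.
    have ki : (k < i.+1)%N := ltn_ord k; have jk : (j < k.+1)%N := ltn_ord j.
    by rewrite (_ : (j < i.+1)%N)//; [rewrite (_ : (k - j < i.+1)%N)//; lia|lia].
  by rewrite coef_poly ltnS leq_subr.
rewrite -mulrA coefM big_ord_recr/= big1 => [|k _].
  rewrite add0r subnn coefM big_ord1 !coef_poly ltnSn /= !npow0.
  by rewrite !mulr1.
suff -> : (A * B)`_(i - k) = 0 by rewrite mulr0.
have ki : (k < i)%N := ltn_ord k.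
transitivity ((\sum_(j < (i - k).+1) npow (- c) j * npow (- - c) (i - k - j))%:C : R[i]).
  rewrite coefM rmorph_sum; apply: eq_bigr => j _.
  have jk : (j < (i - k).+1)%N := ltn_ord j.
  rewrite rmorphM/= opprK !coef_poly.
  by rewrite (_ : (j < i.+1)%N)//; [rewrite (_ : (i - k - j < i.+1)%N)//; lia|lia].
by rewrite npow_conv (_ : (i - k == 0)%N = false)//; lia.
Qed.

Lemma npow_convNK c x i : seq_conv (npow (- c)) (seq_conv (npow c) x) i = x i.
Proof. by have := npow_convK (- c) x i; rewrite opprK. Qed.

Variable al : R.

(** S diag(f) S^-1, where S is the convolution by the coefficients of
    (1 - z)^-al. Its eigenvectors are the columns of S, which for 0 < al < 1/2
    form a basis of l2 that is not unconditional. When f takes the values f k = q (mu k) at the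
    eigenvalues mu k of an operator of this form, it is the image of that
    operator under q, whence the name. As S is lower triangular, it makes sense
    on arbitrary sequences. *)
Definition calc f x : nat -> R[i] :=
  seq_conv (npow al) (fun k => f k * seq_conv (npow (- al)) x k).

Lemma calcDx f x y i : calc f (fun k => x k + y k) i = calc f x i + calc f y i.
Proof.
by rewrite /calc -seq_convD; apply: eq_seq_conv => k _; rewrite seq_convD mulrDr.
Qed.

Lemma calcZx f (a : R[i]) x i : calc f (fun k => a * x k) i = a * calc f x i.
Proof.
by rewrite /calc -seq_convZ; apply: eq_seq_conv => k _; rewrite seq_convZ mulrCA.
Qed.

Lemma eq_calc f g x y i : (forall k, (k <= i)%N -> f k = g k) ->
  (forall k, (k <= i)%N -> x k = y k) -> calc f x i = calc g y i.
Proof.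
move=> fg xy; apply: eq_seq_conv => k ki; rewrite fg//; congr (_ * _).
by apply: eq_seq_conv => j jk; rewrite xy// (leq_trans jk).
Qed.

Lemma calcM f g x i : calc f (calc g x) i = calc (fun k => f k * g k) x i.
Proof.
apply: eq_seq_conv => k _; rewrite -mulrA; congr (_ * _).
exact: npow_convNK.
Qed.

Lemma calc1 x i : calc (fun=> 1) x i = x i.
Proof.
by rewrite -[RHS](npow_convK al); apply: eq_seq_conv => k _; rewrite mul1r.
Qed.

Lemma calcDf f g x i : calc (fun k => f k + g k) x i = calc f x i + calc g x i.
Proof. by rewrite /calc -seq_convD; apply: eq_seq_conv => k _; rewrite mulrDl. Qed.

Lemma calcZf f (a : R[i]) x i : calc (fun k => a * f k) x i = a * calc f x i.
Proof. by rewrite /calc -seq_convZ; apply: eq_seq_conv => k _; rewrite mulrA. Qed.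

Lemma calc_basis f (d : nat -> R[i]) i :
  calc f (seq_conv (npow al) d) i = seq_conv (npow al) (fun k => f k * d k) i.
Proof. by apply: eq_seq_conv => k _; rewrite npow_convNK. Qed.

(** The projection onto the first k vectors of the basis. *)
Definition basis_proj (k : nat) x : nat -> R[i] := calc (fun j => (j < k)%:R) x.

Lemma basis_proj_low k x i : (i < k)%N -> basis_proj k x i = x i.
Proof.
move=> ik; rewrite -[RHS]calc1; apply: eq_calc => // j ji.
by rewrite (leq_ltn_trans ji).
Qed.

(** For i > j the full sum over j <= l <= i of the products of coefficients
    vanishes, so that the part l < k, which defines the projection, is minus the
    part l >= k, which is the kernel. *)
Lemma basis_proj_high k x i : (k <= i)%N ->
  basis_proj k x i = \sum_(j < k) (proj_kernel al (k - j.+1) (i - k))%:C * x j.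
Proof.
move=> ki.
transitivity (\sum_(l < k) \sum_(j < k | (j <= l)%N)
    (npow al (i - l) * npow (- al) (l - j))%:C * x j).
  rewrite /basis_proj /calc /seq_conv.
  rewrite -(big_mkord xpredT (fun l => (npow al (i - l))%:C * ((l < k)%:R *
     \sum_(j < l.+1) (npow (- al) (l - j))%:C * x j))).
  rewrite (big_cat_nat (n := k))//=; last exact: leqW.
  rewrite [X in _ + X]big1_seq ?addr0 => [|l]; last first.
    by rewrite mem_index_iota => /andP[_ /andP[kl _]]; rewrite ltnNge kl mul0r mulr0.
  rewrite big_mkord; apply: eq_bigr => l _; rewrite ltn_ord mul1r mulr_sumr.
  rewrite (big_ord_widen_cond k xpredT (fun j => (npow al (i - l))%:C * ((npow (- al) (l - j))%:C * x j)))//.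
  by apply: eq_big => [j|j _]; rewrite ?ltnS// rmorphM/= mulrA.
rewrite (exchange_big_dep xpredT)//=; apply: eq_bigr => j _.
have jk : (j < k)%N := ltn_ord j.
rewrite -mulr_suml -rmorph_sum; congr (_%:C * _).
have -> : \sum_(l < k | (j <= l)%N) npow al (i - l) * npow (- al) (l - j) =
    \sum_(j <= l < k) npow al (i - l) * npow (- al) (l - j).
  by rewrite (@big_nat_widenl _ _ _ j 0) ?big_mkord.
have := npow_conv_nat al (leq_trans (ltnW jk) ki).
rewrite (big_cat_nat (n := k))//=; [|exact: ltnW|exact: leqW].
rewrite (_ : (i == j) = false); last by lia.
move=> /eqP; rewrite addr_eq0 => /eqP ->.
rewrite proj_kernelE -{1}(add0n k) big_addn subSn// big_mkord -sumrN.
apply: eq_bigr => s _; rewrite mulrN addnC subnDA; congr (- (_ * npow _ _)).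
lia.
Qed.

End Convolution.

(** * Multipliers of bounded variation *)

Section Multipliers.
Variables (R : realType) (al : R).
Implicit Types (x y f g : nat -> R[i]).

Lemma eq_sqsum x y n : (forall i, (i < n)%N -> x i = y i) -> sqsum x n = sqsum y n.
Proof. by move=> h; apply: eq_bigr => i _; rewrite h. Qed.

(** The columns of S form a Schauder basis. *)
Lemma basis_proj_bounded : 0 < al < 2^-1 -> exists2 C, 0 < C &
  forall k n x, sqsum (basis_proj al k x) n <= C * sqsum x n.
Proof.
move=> al01; have [C C0 hC] := proj_kernel_bounded al01.
exists (1 + C) => [|k n x]; first by rewrite addr_gt0.
have [nk|kn] := leqP n k.
  rewrite (@eq_sqsum _ x) => [|i ilt]; last first.
    by rewrite basis_proj_low// (leq_trans ilt).
  by rewrite mulrDl mul1r lerDl mulr_ge0 ?sqsum_ge0// ltW.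
have al1 := lt_half_unit al01.
rewrite -(subnKC (ltnW kn)) mulrDl mul1r.
set m := (n - k)%N.
rewrite {1}/sqsum big_split_ord/= lerD//.
  rewrite [X in X <= _](_ : _ = sqsum x k); last first.
    by apply: eq_bigr => i _; rewrite basis_proj_low.
  by apply: sqsum_nd; exact: leq_addr.
apply: (@le_trans _ _ (C * sqsum x k)); last first.
  by rewrite ler_pM2l//; apply: sqsum_nd; exact: leq_addr.
have := hC k m (fun u => normR (x (k - u.+1)%N)).
rewrite [X in C * X](_ : _ = sqsum x k); last first.
  by rewrite /sqsum [RHS](reindex_inj rev_ord_inj).
apply: le_trans; apply: ler_sum => v _.
rewrite basis_proj_high ?leq_addr// addnC addnK.
rewrite lerXn2r ?nnegrE ?normR_ge0//.
  by apply: sumr_ge0 => u _; rewrite mulr_ge0 ?normR_ge0 ?proj_kernel_ge0.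
apply: le_trans (normR_sum _ _ _) _.
rewrite [X in _ <= X](reindex_inj rev_ord_inj) /=; apply: ler_sum => j _.
rewrite normRM normR_real ger0_norm ?proj_kernel_ge0//.
by rewrite (_ : (k - (k - j.+1).+1)%N = j :> nat)//; have := ltn_ord j; lia.
Qed.

Definition seq_variation f n : R :=
  normR (f n) + \sum_(k < n) normR (f k - f k.+1).

Lemma calc_sumf (I : Type) (r : seq I) (F : I -> nat -> R[i]) x i :
  calc al (fun k => \sum_(j <- r) F j k) x i = \sum_(j <- r) calc al (F j) x i.
Proof.
elim: r => [|j r IH].
  rewrite big_nil (@eq_calc _ _ _ (fun=> 0 * 1) _ x) => [||//]; last first.
    by move=> k _; rewrite big_nil mul0r.
  by rewrite calcZf mul0r.
rewrite big_cons -IH -calcDf; apply: eq_calc => // k _; rewrite big_cons//.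
Qed.

Lemma sum_telescope f (j n : nat) : (j <= n)%N ->
  f j = f n + \sum_(k < n) (f k - f k.+1) * (j < k.+1)%:R.
Proof.
elim: n => [|n IH]; first by rewrite leqn0 => /eqP ->; rewrite big_ord0 addr0.
rewrite leq_eqVlt => /orP[/eqP ->|jn].
  rewrite big1 ?addr0// => k _; rewrite ltnS leqNgt ltn_ord mulr0//.
by rewrite big_ord_recr/= jn mulr1 [LHS]IH//; ring.
Qed.

(** Summation by parts writes S diag(f) S^-1 as a combination of the basis
    projections with coefficients f k - f (k + 1), whence its norm is controlled
    by the variation of f. *)
Lemma calc_abel f x (i n : nat) : (i < n)%N ->
  calc al f x i = f n * x i + \sum_(k < n) (f k - f k.+1) * basis_proj al k.+1 x i.
Proof.
move=> ilt.
rewrite (@eq_calc _ _ _ (fun j => f n * 1 + \sum_(k < n) (f k - f k.+1) * (j < k.+1)%:R) _ x)//.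
  rewrite calcDf calcZf calc1 calc_sumf; congr (_ + _).
  by apply: eq_bigr => k _; rewrite calcZf.
by move=> j ji; rewrite mulr1; apply: sum_telescope; apply: leq_trans ji _; exact: ltnW.
Qed.

Lemma calc_le (C : R) f x n :
  1 <= C -> (forall k n x, sqsum (basis_proj al k x) n <= C * sqsum x n) ->
  sqsum (calc al f x) n <= seq_variation f n ^+ 2 * C * sqsum x n.
Proof.
move=> C1 hC; have C0 : 0 <= C by apply: le_trans C1.
(* the index n stands for the remaining term f n * x *)
pose w k := if (k < n)%N then normR (f k - f k.+1) else normR (f n).
pose y k := if (k < n)%N then basis_proj al k.+1 x else x.
have w0 k : 0 <= w k by rewrite /w; case: ifP => _; exact: normR_ge0.
have wE : \sum_(k < n.+1) w k = seq_variation f n.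
  rewrite big_ord_recr/= /w ltnn addrC; congr (_ + _).
  by apply: eq_bigr => k _; rewrite ltn_ord.
have hy k : sqsum (y k) n <= C * sqsum x n.
  by rewrite /y; case: ifP => _ //; rewrite ler_peMl ?sqsum_ge0.
apply: (@le_trans _ _ (\sum_(i < n) seq_variation f n *
    \sum_(k < n.+1) w k * normR (y k i) ^+ 2)).
  apply: ler_sum => i _; rewrite -wE.
  apply: le_trans (sum_weighted_sqr _ _ _) => //.
  rewrite lerXn2r ?nnegrE ?normR_ge0//.
    by apply: sumr_ge0 => k _; rewrite mulr_ge0 ?normR_ge0.
  rewrite (calc_abel _ _ (ltn_ord i)) addrC big_ord_recr/= {2}/w {2}/y !ltnn.
  apply: le_trans (normRD _ _) _; rewrite normRM lerD2r.
  apply: le_trans (normR_sum _ _ _) _; apply: ler_sum => k _.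
  by rewrite normRM /w /y ltn_ord.
rewrite -mulr_sumr exchange_big/= expr2 -!mulrA ler_wpM2l -?wE//; first exact: sumr_ge0.
rewrite mulr_suml; apply: ler_sum => k _.
by rewrite -mulr_sumr; apply: ler_wpM2l; [exact: w0|exact: hy].
Qed.

End Multipliers.

Section MultiplierOperators.
Variables (R : realType) (al : R).
Hypothesis al01 : 0 < al < 2^-1.
Implicit Types (f g : nat -> R[i]) (x y : l2 R).

Lemma calc_bounded : exists2 C, 0 < C &
  forall f x n, sqsum (calc al f x) n <= (C * seq_variation f n) ^+ 2 * sqsum x n.
Proof.
have [C C0 hC] := basis_proj_bounded al01.
exists (Num.sqrt (1 + C)); first by rewrite sqrtr_gt0 addr_gt0.
move=> f x n; rewrite exprMn sqr_sqrtr; last by rewrite addr_ge0// ltW.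
rewrite [(1 + C) * _]mulrC.
apply: calc_le => [|k m y]; first by rewrite lerDl ltW.
apply: le_trans (hC _ _ _) _.
by rewrite ler_wpM2r ?sqsum_ge0// lerDr.
Qed.

(** The norm of a multiplier is at most this constant times its variation. *)
Definition calc_const : R := projT1 (cid2 calc_bounded).

Lemma calc_const_gt0 : 0 < calc_const.
Proof. by rewrite /calc_const; case: cid2. Qed.

Lemma calc_constP f x n :
  sqsum (calc al f x) n <= (calc_const * seq_variation f n) ^+ 2 * sqsum x n.
Proof. by rewrite /calc_const; case: cid2 => C /= _; apply. Qed.

Definition bv_seq f := exists V, forall n, seq_variation f n <= V.

Lemma calc_l2 f : bv_seq f -> forall x, calc al f x \in @square_summable R.
Proof.
move=> [V hV] x; apply/square_summableP.
exists ((calc_const * V) ^+ 2 * sqnorm x) => n.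
apply: le_trans (calc_constP _ _ _) _.
have vn : 0 <= seq_variation f n.
  by rewrite addr_ge0 ?normR_ge0// sumr_ge0// => k _; exact: normR_ge0.
apply: ler_pM; rewrite ?sqr_ge0 ?sqsum_ge0 ?sqsum_le_sqnorm//.
have c0 := ltW calc_const_gt0.
have V0 : 0 <= V by apply: le_trans (hV n).
by rewrite lerXn2r ?nnegrE ?mulr_ge0// ler_wpM2l.
Qed.

Definition multiplier f (bf : bv_seq f) x : l2 R := L2 (calc_l2 bf x).

Section Linear.
Variables (f : nat -> R[i]) (bf : bv_seq f).

Lemma multiplier_linear : linear (multiplier bf).
Proof.
move=> a x y; apply: l2P => i.
rewrite -[LHS]/(calc al f (fun k => a * x k + y k) i).
by rewrite calcDx calcZx.
Qed.

HB.instance Definition _ :=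
  GRing.isLinear.Build R[i] (l2 R) (l2 R) *:%R (multiplier bf) multiplier_linear.
End Linear.

Lemma multiplier_norm f (bf : bv_seq f) (V : R) x :
  (forall n, seq_variation f n <= V) ->
  normR (multiplier bf x) <= calc_const * V * normR x.
Proof.
move=> hV; rewrite !normR_l2.
have V0 : 0 <= V.
  by apply: le_trans (hV 0); rewrite /seq_variation big_ord0 addr0 normR_ge0.
have c0 := ltW calc_const_gt0.
apply: l2norm_le => [|n]; first by rewrite !mulr_ge0// sqrtr_ge0.
apply: le_trans (calc_constP _ _ _) _; rewrite [X in _ <= X]exprMn.
have vn : 0 <= seq_variation f n.
  by rewrite addr_ge0 ?normR_ge0// sumr_ge0// => k _; exact: normR_ge0.
apply: ler_pM; rewrite ?sqr_ge0 ?sqsum_ge0 ?sqsum_le_l2norm//.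
by rewrite lerXn2r ?nnegrE ?mulr_ge0// ler_wpM2l.
Qed.

Lemma opnorm_multiplier f (bf : bv_seq f) (V : R) :
  (forall n, seq_variation f n <= V) ->
  (opnorm (multiplier bf) <= (calc_const * V)%:E)%E.
Proof.
move=> hV; apply: ge_ereal_sup => _ [x /= x1 <-]; rewrite lee_fin.
apply: le_trans (multiplier_norm _ _ hV) _.
have V0 : 0 <= V.
  by apply: le_trans (hV 0); rewrite /seq_variation big_ord0 addr0 normR_ge0.
by rewrite ler_piMr ?mulr_ge0 ?(ltW calc_const_gt0)// -normR_le1.
Qed.

End MultiplierOperators.

(** * The operator and its resolvent *)

Section Nodes.
Variable R : realType.
Implicit Types (z : R[i]).

(** The terms are the increments of d / (d + s k), which lies between 0 and 1.
    This is used both for the variation of the resolvent and for the square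
    functions. *)
Lemma sum_resolvent_gap (s : nat -> R) (d : R) n : 0 <= d -> (forall k, 0 < s k) ->
  \sum_(k < n) d * (s k - s k.+1) / ((d + s k) * (d + s k.+1)) <= 1.
Proof.
move=> d0 s0; have ds k : 0 < d + s k by rewrite ltr_wpDl.
have -> : \sum_(k < n) d * (s k - s k.+1) / ((d + s k) * (d + s k.+1)) =
    d / (d + s n) - d / (d + s 0).
  elim: n => [|n IH]; first by rewrite big_ord0 subrr.
  rewrite big_ord_recr/= IH; have := ds n; have := ds n.+1; have := ds 0.
  by move=> h0 h1 h2; field; rewrite !gt_eqF.
have h1 : d / (d + s n) <= 1 by rewrite ler_pdivrMr// mul1r lerDl ltW.
have h2 : 0 <= d / (d + s 0) by rewrite divr_ge0// ltW.
lra.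
Qed.

(** The eigenvalues 1 - 256^-k tend to 1 geometrically. The ratio 256 is large
    enough for the block polynomials below to separate successive eigenvalues. *)
Definition gap (k : nat) : R := 256%:R ^- k.

Definition node (k : nat) : R := 1 - gap k.

Lemma gap_gt0 k : 0 < gap k.
Proof. by rewrite invr_gt0 exprn_gt0. Qed.

Lemma gap0 : gap 0 = 1.
Proof. by rewrite /gap expr0 invr1. Qed.

Lemma gapS k : gap k.+1 = gap k / 256%:R.
Proof. by rewrite /gap exprSr invfM. Qed.

Lemma gap_le1 k : gap k <= 1.
Proof. by rewrite invf_le1 ?exprn_gt0// exprn_ege1// ler1n. Qed.

Lemma gapS_le k : gap k.+1 <= gap k.
Proof. by rewrite gapS; have := gap_gt0 k; lra. Qed.

Lemma node_ge0 k : 0 <= node k.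
Proof. by rewrite subr_ge0 gap_le1. Qed.

Lemma node_le1 k : node k <= 1.
Proof. by rewrite gerBl ltW// gap_gt0. Qed.

Lemma normR_nodeB k : normR ((node k)%:C - (node k.+1)%:C) = gap k - gap k.+1.
Proof.
rewrite -rmorphB normR_real /node.
have -> : 1 - gap k - (1 - gap k.+1) = - (gap k - gap k.+1) by ring.
by rewrite normrN ger0_norm// subr_ge0 gapS_le.
Qed.

Definition node_fun (k : nat) : R[i] := (node k)%:C.

Lemma node_variation n : seq_variation node_fun n <= 2.
Proof.
rewrite /seq_variation.
have -> : \sum_(k < n) normR (node_fun k - node_fun k.+1) = 1 - gap n :> R.
  elim: n => [|n IH]; first by rewrite big_ord0 gap0 subrr.
  by rewrite big_ord_recr/= IH normR_nodeB; ring.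
rewrite normR_real ger0_norm ?node_ge0//.
by have := node_le1 n; have := gap_gt0 n; lra.
Qed.

Lemma node_bv : bv_seq node_fun.
Proof. by exists 2; exact: node_variation. Qed.

Section Resolvent.
Variable z : R[i].
Hypothesis z1 : 1 < normR z.

(** Because |z| > 1, the distance |z - node k| is at least gap k, while |z - 1| is
    at most |z - node k| + gap k. *)
Lemma dist_node k : normR (z - 1) + gap k <= 3 * normR (z - node_fun k).
Proof.
have h1 : normR z <= normR (z - node_fun k) + node k.
  have := normRD (z - node_fun k) (node_fun k).
  by rewrite subrK [normR (node_fun k)]normR_real ger0_norm ?node_ge0.
have h2 : normR (z - 1) <= normR (z - node_fun k) + gap k.
  have := normRB (z - node_fun k) (gap k)%:C.
  rewrite normR_real ger0_norm ?(ltW (gap_gt0 k))//.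
  have -> // : z - node_fun k - (gap k)%:C = z - 1.
  rewrite -addrA -opprD; congr (_ - _).
  by rewrite /node_fun -rmorphD /node subrK.
by move: h1 h2 z1; rewrite /node; lra.
Qed.

Lemma dist_node_gt0 k : 0 < normR (z - node_fun k).
Proof. by have := dist_node k; have := gap_gt0 k; have := normR_ge0 (z - 1); lra. Qed.

Lemma z_neq_node k : z - node_fun k != 0.
Proof. by apply: contraTneq (dist_node_gt0 k) => ->; rewrite normR0 ltxx. Qed.

Lemma z_neq1 : z - 1 != 0.
Proof.
rewrite subr_eq0; apply: contraTneq z1 => ->.
by rewrite (normR_real 1) normr1 ltxx.
Qed.

(** The values at the eigenvalues of the function whose image is
    (z - 1) R(z, T). *)
Definition res_fun k : R[i] := (z - 1) / (z - node_fun k).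

Lemma res_fun_variation n : seq_variation res_fun n <= 12.
Proof.
set d := normR (z - 1); have d0 : 0 <= d by exact: normR_ge0.
have ds k : 0 < d + gap k by rewrite ltr_wpDl ?gap_gt0.
have inv k : (normR (z - node_fun k))^-1 <= 3 / (d + gap k).
  rewrite -[leLHS]mul1r ler_pdivrMr ?dist_node_gt0// mulrAC ler_pdivlMr// mul1r.
  exact: dist_node.
have h1 : normR (res_fun n) <= 3.
  rewrite normRM normRV -/d; apply: (@le_trans _ _ (d * (3 / (d + gap n)))).
    by rewrite ler_wpM2l.
  by rewrite mulrA ler_pdivrMr//; have := gap_gt0 n; nra.
have h2 k : normR (res_fun k - res_fun k.+1) <=
    9 * (d * (gap k - gap k.+1) / ((d + gap k) * (d + gap k.+1))).
  have -> : res_fun k - res_fun k.+1 =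
      (z - 1) * (node_fun k - node_fun k.+1) * ((z - node_fun k)^-1 * (z - node_fun k.+1)^-1).
    by rewrite /res_fun; field; rewrite !z_neq_node.
  rewrite !normRM !normRV normR_nodeB -/d.
  have -> : 9 * (d * (gap k - gap k.+1) / ((d + gap k) * (d + gap k.+1))) =
    d * (gap k - gap k.+1) * (3 / (d + gap k) * (3 / (d + gap k.+1))).
    by field; rewrite !gt_eqF.
  apply: ler_wpM2l; first by rewrite mulr_ge0// subr_ge0 gapS_le.
  by apply: ler_pM; rewrite ?invr_ge0 ?normR_ge0.
have h3 : \sum_(k < n) normR (res_fun k - res_fun k.+1) <= 9.
  apply: (@le_trans _ _ (\sum_(k < n)
      9 * (d * (gap k - gap k.+1) / ((d + gap k) * (d + gap k.+1))))).
    by apply: ler_sum => k _; exact: h2.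
  by rewrite -mulr_sumr ler_piMr// sum_resolvent_gap// => k; exact: gap_gt0.
by rewrite /seq_variation; move: h1 h3; lra.
Qed.

Lemma res_fun_bv : bv_seq res_fun.
Proof. by exists 12; exact: res_fun_variation. Qed.

Lemma variationZ (a : R[i]) (f : nat -> R[i]) n :
  seq_variation (fun k => a * f k) n = normR a * seq_variation f n.
Proof.
rewrite /seq_variation normRM mulrDr; congr (_ + _).
rewrite mulr_sumr; apply: eq_bigr => k _.
by rewrite -mulrBr normRM.
Qed.

(** These are the values 1 / (z - lambda) for the resolvent itself. The bound
    depends on z, but shows that z belongs to the resolvent set. *)
Lemma inv_fun_bv : bv_seq (fun k => (z - 1)^-1 * res_fun k).
Proof.
exists (normR (z - 1)^-1 * 12) => n.
by rewrite variationZ ler_wpM2l ?normR_ge0// res_fun_variation.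
Qed.

End Resolvent.

Variable al : R.
Hypothesis al01 : 0 < al < 2^-1.

Definition ritt_op : l2 R -> l2 R := multiplier al01 node_bv.

HB.instance Definition _ := GRing.Linear.on ritt_op.

Lemma scalar_sub_ritt z (x : l2 R) i :
  scalar_sub z ritt_op x i = calc al (fun k => z - node_fun k) x i.
Proof.
have -> : calc al (fun k => z - node_fun k) x i =
    calc al (fun k => z * 1 + (-1) * node_fun k) x i.
  by apply: eq_calc => // k _; rewrite mulr1 mulN1r.
rewrite calcDf !calcZf calc1 mulN1r.
by rewrite /scalar_sub l2D l2N l2Z.
Qed.

Section Inverse.
Variable z : R[i].
Hypothesis z1 : 1 < normR z.

Definition ritt_resolvent : l2 R -> l2 R := multiplier al01 (inv_fun_bv z1).

HB.instance Definition _ := GRing.Linear.on ritt_resolvent.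

Lemma inv_funE k : (z - node_fun k) * ((z - 1)^-1 * res_fun z k) = 1.
Proof.
by rewrite /res_fun; field; rewrite z_neq1// z_neq_node.
Qed.

Lemma ritt_resolventK : cancel ritt_resolvent (scalar_sub z ritt_op).
Proof.
move=> x; apply: l2P => i; rewrite scalar_sub_ritt.
rewrite -[RHS](calc1 al) calcM; apply: eq_calc => // k _; exact: inv_funE.
Qed.

Lemma scalar_subK : cancel (scalar_sub z ritt_op) ritt_resolvent.
Proof.
move=> x; apply: l2P => i.
rewrite -[LHS]/(calc al _ (scalar_sub z ritt_op x) i).
rewrite (@eq_calc _ _ _ (fun k => (z - 1)^-1 * res_fun z k) _
  (calc al (fun k => z - node_fun k) x))// => [|k _]; last exact: scalar_sub_ritt.
rewrite calcM -[RHS](calc1 al); apply: eq_calc => // k _.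
by rewrite mulrC inv_funE.
Qed.

Lemma resolventE x : resolvent z ritt_op x = ritt_resolvent x.
Proof.
apply: (can_inj scalar_subK); rewrite ritt_resolventK /resolvent pinvK//.
apply/mem_set; exists (ritt_resolvent x) => //; exact: ritt_resolventK.
Qed.

End Inverse.

Lemma ritt_op_bounded : bounded_op ritt_op.
Proof. exact: le_lt_trans (opnorm_multiplier al01 node_bv node_variation) (ltry _). Qed.

Lemma ritt_op_tadmor_ritt : tadmor_ritt ritt_op.
Proof.
split; first exact: ritt_op_bounded.
  move=> z /= zs; rewrite normR_le1 leNgt; apply/negP => z1; apply: zs.
  exists (ritt_resolvent z1); split; [|exact: ritt_resolventK|exact: scalar_subK].
  apply: le_lt_trans (opnorm_multiplier al01 _ _) (ltry (calc_const al01 * (normR (z - 1)^-1 * 12))).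
  by move=> n; rewrite variationZ ler_wpM2l ?normR_ge0// res_fun_variation.
apply: le_lt_trans (ltry (calc_const al01 * 12)).
apply: ge_ereal_sup => _ [z /= z1 <-].
have {}z1 : 1 < normR z by rewrite -normRE ltcR in z1.
have -> : (fun x => (z - 1) *: resolvent z ritt_op x) =
    multiplier al01 (res_fun_bv z1).
  apply/funext => x; rewrite (resolventE z1); apply: l2P => i.
  rewrite l2Z -[LHS]calcZf; apply: eq_calc => // k _.
  by rewrite mulrA mulfV ?mul1r// z_neq1.
exact: opnorm_multiplier (res_fun_variation z1).
Qed.

End Nodes.

(** * Young's inequalities for convolutions *)

Section Young.
Variable R : realType.
Implicit Types (b g : nat -> R) (x d : nat -> R[i]).

(** Convolution as a square matrix, to which Schur's test applies. *)
Definition toeplitz g (i j : nat) : R := if (j <= i)%N then g (i - j)%N else 0.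

Lemma toeplitz_ge0 g i j : (forall k, 0 <= g k) -> 0 <= toeplitz g i j.
Proof. by move=> g0; rewrite /toeplitz; case: ifP. Qed.

Lemma toeplitz_row g (i n : nat) (F : nat -> R) : (i < n)%N ->
  \sum_(j < n) toeplitz g i j * F j = \sum_(j < i.+1) g (i - j)%N * F j.
Proof.
move=> ilt; rewrite (big_ord_widen_cond n xpredT (fun j => g (i - j)%N * F j))//.
rewrite [RHS]big_mkcond; apply: eq_bigr => j _; rewrite /toeplitz ltnS.
by case: ifP; rewrite ?mul0r.
Qed.

Lemma toeplitz_row_sum g (i n : nat) (C : R) : (forall k, 0 <= g k) ->
  (forall m, \sum_(k < m) g k <= C) -> \sum_(j < n) toeplitz g i j <= C.
Proof.
move=> g0 hC; apply: (@le_trans _ _ (\sum_(j < n + i.+1) toeplitz g i j)).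
  rewrite big_split_ord/= lerDl sumr_ge0// => k _; exact: toeplitz_ge0.
under eq_bigr do rewrite -[toeplitz _ _ _]mulr1.
rewrite (@toeplitz_row g i _ (fun=> 1)); last by lia.
rewrite (reindex_inj rev_ord_inj)/= (le_trans _ (hC i.+1))//.
apply: ler_sum => k _; rewrite mulr1 subSS subKn//; exact: leq_ord.
Qed.

Lemma toeplitz_col_sum g (j n : nat) (C : R) : (forall k, 0 <= g k) ->
  (forall m, \sum_(k < m) g k <= C) -> \sum_(i < n) toeplitz g i j <= C.
Proof.
move=> g0 hC; apply: le_trans (hC (n - j)%N).
have [nj|jn] := leqP n j.
  rewrite (_ : (n - j)%N = 0%N); last by lia.
  rewrite big_ord0 big1// => i _; rewrite /toeplitz leqNgt.
  by rewrite (leq_trans (ltn_ord i)).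
rewrite -(big_mkord xpredT (fun i => toeplitz g i j)).
rewrite (big_cat_nat (n := j))//=; last exact: ltnW.
rewrite big_nat_cond big1 ?add0r => [|i]; last first.
  by rewrite andbT /toeplitz => /andP[_ ij]; rewrite leqNgt ij.
rewrite -{1}(add0n j) big_addn big_mkord; apply: ler_sum => k _.
by rewrite /toeplitz leq_addl addnK.
Qed.

Lemma normR_conv b x (i n : nat) : (i < n)%N ->
  normR (seq_conv b x i) <= \sum_(j < n) toeplitz (fun k => `|b k|) i j * normR (x j).
Proof.
move=> ilt; rewrite (@toeplitz_row _ _ _ (fun j => normR (x j)))//.
apply: le_trans (normR_sum _ _ _) _; apply: ler_sum => j _.
by rewrite normRM normR_real.
Qed.

Lemma sqsum_conv_l1 b (A : R) x n : (forall m, \sum_(k < m) `|b k| <= A) ->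
  sqsum (seq_conv b x) n <= A ^+ 2 * sqsum x n.
Proof.
move=> hA; have A0 : 0 <= A by have := hA 0; rewrite big_ord0.
have g0 k : 0 <= `|b k| by [].
apply: (@le_trans _ _ (\sum_(i < n)
    (\sum_(j < n) toeplitz (fun k => `|b k|) i j * normR (x j)) ^+ 2)).
  apply: ler_sum => i _; rewrite lerXn2r ?nnegrE ?normR_ge0 ?normR_conv//.
  by apply: sumr_ge0 => j _; rewrite mulr_ge0 ?normR_ge0 ?toeplitz_ge0.
rewrite expr2; apply: (@schur_test R n n (toeplitz (fun k => `|b k|)) (fun=> 1) (fun=> 1)
  A A (fun j => normR (x j))) => //.
- by move=> i j; exact: toeplitz_ge0.
- by move=> i; under eq_bigr do rewrite mulr1; rewrite mulr1; exact: toeplitz_row_sum.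
- by move=> j; under eq_bigr do rewrite mulr1; rewrite mulr1; exact: toeplitz_col_sum.
Qed.

Lemma sqsum_conv_l2 b (B : R) d n : (forall m, \sum_(k < m) b k ^+ 2 <= B) ->
  sqsum (seq_conv b d) n <= B * (\sum_(j < n) normR (d j)) ^+ 2.
Proof.
move=> hB; set D := \sum_(j < n) normR (d j).
have D0 : 0 <= D by apply: sumr_ge0 => j _; exact: normR_ge0.
apply: (@le_trans _ _ (\sum_(i < n) D *
    \sum_(j < n) normR (d j) * toeplitz (fun k => `|b k|) i j ^+ 2)).
  apply: ler_sum => i _.
  apply: le_trans (sum_weighted_sqr _ _ _); last by move=> j _; exact: normR_ge0.
  rewrite lerXn2r ?nnegrE ?normR_ge0//.
    by apply: sumr_ge0 => j _; rewrite mulr_ge0 ?normR_ge0 ?toeplitz_ge0.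
  apply: le_trans (normR_conv _ _ (ltn_ord i)) _.
  by under eq_bigr do rewrite mulrC.
rewrite -mulr_sumr exchange_big/= expr2 mulrCA ler_wpM2l// mulr_sumr.
apply: ler_sum => j _; rewrite -mulr_sumr mulrC ler_wpM2r ?normR_ge0//.
have e i : toeplitz (fun k => `|b k|) i j ^+ 2 = toeplitz (fun k => b k ^+ 2) i j.
  by rewrite /toeplitz; case: ifP; rewrite ?expr0n// real_normK ?num_real.
under eq_bigr do rewrite e.
by apply: toeplitz_col_sum => // k; exact: sqr_ge0.
Qed.

End Young.

(** * Square function estimates *)

Section SquareFunction.
Variable R : realType.

Lemma sum_deriv_geometric (t : R) n : 0 <= t <= 1 ->
  (1 - t) ^+ 2 * \sum_(k < n) k.+1%:R * t ^+ k <= 1.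
Proof.
move=> /andP[t0 t1].
have -> : (1 - t) ^+ 2 * \sum_(k < n) k.+1%:R * t ^+ k =
    1 - t ^+ n * (1 + n%:R * (1 - t)).
  elim: n => [|n IH]; first by rewrite big_ord0 mulr0 expr0 mul0r addr0 mulr1 subrr.
  by rewrite big_ord_recr/= mulrDr IH -nat1r [t ^+ n.+1]exprSr; ring.
by rewrite gerBl mulr_ge0 ?exprn_ge0// addr_ge0// mulr_ge0// subr_ge0.
Qed.

(** The Gram matrix of the sequences sqrt(n + 1) gap_j node_j^n, up to a
    truncation of the sum over n. It is comparable to
    gap_j gap_l / (gap_j + gap_l)^2, so to 256^-|j - l|. *)
Let m (j l : nat) : R := gap R j * gap R l / (1 - node R j * node R l) ^+ 2.

Let m_le j l : m j l <= 8 * (gap R j * (gap R l - gap R l.+1) /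
  ((gap R j + gap R l) * (gap R j + gap R l.+1))).
Proof.
rewrite /m /node gapS; set a := gap R j; set b := gap R l.
have a0 : 0 < a by exact: gap_gt0. have b0 : 0 < b by exact: gap_gt0.
have a1 : a <= 1 by exact: gap_le1. have b1 : b <= 1 by exact: gap_le1.
have h0 : (a + b) / 2 <= 1 - (1 - a) * (1 - b) by nra.
have ab : 0 < (a + b) / 2 by rewrite divr_gt0// addr_gt0.
apply: (@le_trans _ _ (a * b / ((a + b) / 2) ^+ 2)).
  rewrite ler_pM2l ?mulr_gt0// lef_pV2 ?posrE ?exprn_gt0//; last exact: lt_le_trans h0.
  by rewrite lerXn2r ?nnegrE ?(ltW ab)// (le_trans _ h0)// ltW.
have b6 : 0 < b / 256 by rewrite divr_gt0.
rewrite mulrA ler_pdivrMr ?exprn_gt0// mulrAC ler_pdivlMr ?mulr_gt0 ?addr_gt0//.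
have -> : 8 * (a * (b - b / 256)) * ((a + b) / 2) ^+ 2 =
  a * b * ((a + b) * ((255/128) * (a + b))) by field.
rewrite ler_pM2l ?mulr_gt0// ler_pM2l ?addr_gt0//; lra.
Qed.

Let m_row j n : \sum_(l < n) m j l <= 8.
Proof.
apply: (@le_trans _ _ (\sum_(l < n) 8 * (gap R j * (gap R l - gap R l.+1) /
  ((gap R j + gap R l) * (gap R j + gap R l.+1))))).
  by apply: ler_sum => l _; exact: m_le.
rewrite -mulr_sumr ler_piMr// sum_resolvent_gap ?ltW ?gap_gt0//.
exact: gap_gt0.
Qed.

(** The matrix sqrt(n + 1) gap_j node_j^n is bounded on l2: expanding the square
    leads to the Gram matrix, whose rows have bounded sums. *)
Lemma square_function_matrix (y : nat -> R) M N :
  \sum_(n < N) n.+1%:R * (\sum_(j < M) y j * gap R j * node R j ^+ n) ^+ 2 <=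
  8 * \sum_(j < M) y j ^+ 2.
Proof.
pose z j := `|y j|.
have z0 j : 0 <= z j by exact: normr_ge0.
have m0 j l : 0 <= m j l.
  by rewrite divr_ge0 ?sqr_ge0// mulr_ge0// ltW// gap_gt0.
have mC j l : m j l = m l j by rewrite /m [gap R j * _]mulrC [node R j * _]mulrC.
apply: (@le_trans _ _ (\sum_(j < M) \sum_(l < M) z j * z l * m j l)).
  apply: (@le_trans _ _ (\sum_(n < N) \sum_(j < M) \sum_(l < M)
      z j * z l * (gap R j * gap R l) * (n.+1%:R * (node R j * node R l) ^+ n))).
    apply: ler_sum => n _.
    apply: (@le_trans _ _ (n.+1%:R * (\sum_(j < M) z j * gap R j * node R j ^+ n) ^+ 2)).
      rewrite ler_wpM2l// -real_normK ?num_real// lerXn2r ?nnegrE//.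
        by apply: sumr_ge0 => j _; rewrite !mulr_ge0 ?exprn_ge0 ?node_ge0// ltW// gap_gt0.
      apply: le_trans (ler_norm_sum _ _ _) _; apply: ler_sum => j _.
      rewrite !normrM -/(z j) ger0_norm ?(ltW (gap_gt0 _ _))// ger0_norm//.
      by rewrite exprn_ge0// node_ge0.
    rewrite expr2 mulr_suml mulr_sumr; apply: ler_sum => j _.
    rewrite !mulr_sumr; apply: ler_sum => l _.
    by rewrite exprMn le_eqVlt; apply/orP; left; apply/eqP; ring.
  rewrite exchange_big/=; apply: ler_sum => j _.
  rewrite exchange_big/=; apply: ler_sum => l _.
  rewrite -mulr_sumr /m [X in _ <= X]mulrA ler_pdivlMr; last first.
    rewrite exprn_gt0// subr_gt0.
    have := gap_gt0 R j; have := gap_gt0 R l; have := node_ge0 R j.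
    by have := node_ge0 R l; rewrite /node; nra.
  rewrite -[X in X <= _]mulrA; apply: ler_piMr.
    by rewrite !mulr_ge0// ltW// gap_gt0.
  rewrite mulrC; apply: sum_deriv_geometric.
  by rewrite mulr_ge0 ?node_ge0//= mulr_ile1 ?node_ge0 ?node_le1.
apply: (@le_trans _ _ (\sum_(j < M) \sum_(l < M)
    (2^-1 * (z j ^+ 2 * m j l) + 2^-1 * (z l ^+ 2 * m l j)))).
  apply: ler_sum => j _; apply: ler_sum => l _; rewrite (mC l j).
  by have := sqr_ge0 (z j - z l); have := m0 j l; nra.
under eq_bigr do rewrite big_split/=.
rewrite big_split/= [X in _ + X]exchange_big/=.
have -> : forall a : R, a + a = 2 * a by move=> a; ring.
rewrite mulr_sumr [X in _ <= X]mulr_sumr; apply: ler_sum => j _.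
rewrite -!mulr_sumr /z real_normK ?num_real// mulrA divff ?pnatr_eq0// mul1r.
by rewrite [X in _ <= X]mulrC ler_wpM2l ?sqr_ge0 ?m_row.
Qed.

End SquareFunction.

Section RittSquareFunction.
Variables (R : realType) (al : R).
Hypothesis al01 : 0 < al < 2^-1.

Lemma iter_ritt k (x : l2 R) i :
  iter k (ritt_op al01) x i = calc al (fun j => node_fun R j ^+ k) x i.
Proof.
elim: k i => [|k IH] i.
  by rewrite /= -[LHS](calc1 al); apply: eq_calc => // j _; rewrite expr0.
rewrite iterS -[LHS]/(calc al (node_fun R) (iter k (ritt_op al01) x) i).
rewrite (@eq_calc _ _ _ (node_fun R) _ (calc al (fun j => node_fun R j ^+ k) x))//.
by rewrite calcM; apply: eq_calc => // j _; rewrite exprS.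
Qed.

(** S^-1 is bounded: apart from the first one, the coefficients of (1 - z)^al are
    negative, and their sum is -1. *)
Lemma npow_opp_l1 n : \sum_(k < n) `|npow (- al) k| <= 2.
Proof.
have al1 := lt_half_unit al01.
case: n => [|n]; first by rewrite big_ord0.
rewrite big_ord_recl/= npow0 normr1.
have := proj_kernel_sum_le1 0 n al1.
rewrite (eq_bigr (fun k : 'I_n => `|npow (- al) (bump 0 k)|)) => [|k _]; first lra.
by rewrite -[LHS]ger0_norm ?proj_kernel_ge0// proj_kernel0 normrN.
Qed.

Lemma sqsum_calc_le (B : R) f (x : nat -> R[i]) n :
  (forall m, \sum_(k < m) npow al k ^+ 2 <= B) ->
  sqsum (calc al f x) n <=
  B * (\sum_(j < n) normR (seq_conv (npow (- al)) x j) * normR (f j)) ^+ 2.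
Proof.
move=> hB; apply: le_trans (sqsum_conv_l2 _ _ hB) _.
rewrite le_eqVlt; apply/orP; left; apply/eqP; congr (_ * _ ^+ 2).
by apply: eq_bigr => j _; rewrite normRM mulrC.
Qed.

(** The coefficients c = S^-1 x of a vector are square-summable, and the basis
    vectors are bounded in norm. Hence the norm of T^(n+1) x - T^n x is at most a
    multiple of the sum of |c_j| gap_j node_j^n, and [square_function_matrix]
    applies. *)
Lemma ritt_square_function : square_function_estimates (ritt_op al01).
Proof.
have [B B0 hB] := npow_square_summable al01.
exists (Num.sqrt (32 * B)); first by rewrite sqrtr_gt0 mulr_gt0.
move=> x; set T := ritt_op al01.
pose y k : l2 R := iter k T x - iter k.-1 T x.
have key N M : \sum_(n < N) n.+1%:R * sqsum (y n.+1) M <= 32 * B * normR x ^+ 2.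
  pose c j := normR (seq_conv (npow (- al)) x j).
  apply: (@le_trans _ _ (\sum_(n < N) n.+1%:R *
      (B * (\sum_(j < M) c j * gap R j * node R j ^+ n) ^+ 2))).
    apply: ler_sum => n _; rewrite ler_wpM2l//.
    rewrite (@eq_sqsum _ _ (calc al (fun j => node_fun R j ^+ n * - (gap R j)%:C) x)) => [|i _].
      apply: le_trans (sqsum_calc_le _ _ _ hB) _.
      rewrite le_eqVlt; apply/orP; left; apply/eqP; congr (_ * _ ^+ 2).
      apply: eq_bigr => j _; rewrite normRM normRN normRX !normR_real.
      by rewrite !ger0_norm ?node_ge0// ?(ltW (gap_gt0 _ _))// -mulrA [gap R j * _]mulrC.
    rewrite /y l2D l2N !iter_ritt -mulN1r -calcZf -calcDf; apply: eq_calc => // j _.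
    rewrite exprS mulN1r -{2}(mul1r (_ ^+ n)) -mulrBl mulrC; congr (_ * _).
    by rewrite /node_fun /node rmorphB rmorph1 addrAC subrr add0r.
  have := square_function_matrix c M N.
  have hc : \sum_(j < M) c j ^+ 2 <= 4 * normR x ^+ 2.
    have := sqsum_conv_l1 x M npow_opp_l1.
    have := sqsum_le_l2norm x M; rewrite -normR_l2 /sqsum -/(c _).
    rewrite -[(2 : R) ^+ 2]/(2 * 2 : R); lra.
  move=> h; rewrite (eq_bigr (fun n : 'I_N => B * (n.+1%:R *
      (\sum_(j < M) c j * gap R j * node R j ^+ n) ^+ 2))) => [|n _]; last by rewrite mulrCA.
  rewrite -mulr_sumr [32 * B]mulrC -mulrA ler_pM2l//.
  by apply: le_trans h _; lra.
(* let the truncation M of the sequences tend to infinity *)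
have key2 N : \sum_(n < N) n.+1%:R * normR (y n.+1) ^+ 2 <= 32 * B * normR x ^+ 2.
  have cv : (fun M => \sum_(n < N) n.+1%:R * sqsum (y n.+1) M) @ \oo -->
      \sum_(n < N) n.+1%:R * normR (y n.+1) ^+ 2.
    elim: N => [|N IH].
      rewrite (_ : (fun _ => _) = cst 0); first by rewrite big_ord0; exact: cvg_cst.
      by apply/funext => M; rewrite big_ord0.
    rewrite big_ord_recr/= (_ : (fun M => _) = (fun M =>
      \sum_(n < N) n.+1%:R * sqsum (y n.+1) M + N.+1%:R * sqsum (y N.+1) M)); last first.
      by apply/funext => M; rewrite big_ord_recr.
    apply: cvgD; first exact: IH.
    apply: cvgM; first exact: cvg_cst.
    by rewrite normR_l2 sqr_sqrtr ?sqnorm_ge0//; exact: cvg_sqsum.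
  rewrite -(cvg_lim _ cv)//; apply: limr_le; first by apply/cvg_ex; exists (\sum_(n < N) n.+1%:R * normR (y n.+1) ^+ 2).
  by apply: nearW => M; exact: key.
rewrite sqr_sqrtr; last by rewrite mulr_ge0// ltW.
apply: lime_le.
  apply: is_cvg_nneseries => n _ _; rewrite lee_fin mulr_ge0// sqr_ge0//.
apply: nearW => n; rewrite sumEFin lee_fin.
case: n => [|n]; first by rewrite big_geq// mulr_ge0 ?sqr_ge0// mulr_ge0// ltW.
by rewrite big_add1/= big_mkord; exact: key2.
Qed.

End RittSquareFunction.

(** * Bounded polynomials with prescribed signs at the eigenvalues *)

Section BlockPolynomials.
Variable R : realType.
Implicit Types (z : R[i]) (M : nat) (t : R).

(** The average of z^k over M <= k < 2 M. In the disc it is close to 1 when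
    M |1 - z| is small, and it is small when M |1 - z| is large. Plain monomials
    would not do, for they do not decay away from 1. *)
Definition block_poly M : {poly R[i]} :=
  (M%:R^-1)%:C *: \sum_(k < M) 'X^(M + k).

Lemma coef_block_poly M k :
  (block_poly M)`_k = if (M <= k < M + M)%N then (M%:R^-1)%:C else 0.
Proof.
rewrite coefZ coef_sum; case: ifP => [/andP[Mk kM]|h].
  have kM' : (k - M < M)%N by lia.
  rewrite (bigD1 (Ordinal kM'))//= subnKC// coefXn eqxx big1 ?addr0 ?mulr1// => j jk.
  rewrite coefXn; case: eqP => // kj; case/eqP: jk; apply: val_inj => /=.
  by rewrite kj addKn.
rewrite big1 ?mulr0// => j _; rewrite coefXn; case: eqP => // kj.
by move: h; rewrite kj leq_addr ltn_add2l ltn_ord.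
Qed.

Lemma block_polyE M z :
  (block_poly M).[z] = (M%:R^-1)%:C * \sum_(k < M) z ^+ (M + k).
Proof.
by rewrite hornerZ horner_sum; congr (_ * _); apply: eq_bigr => k _; rewrite hornerXn.
Qed.

Definition block_avg M t : R := M%:R^-1 * \sum_(k < M) t ^+ (M + k).

Lemma block_poly_real M t : (block_poly M).[t%:C] = (block_avg M t)%:C.
Proof.
rewrite block_polyE rmorphM rmorph_sum; congr (_ * _).
by apply: eq_bigr => k _; rewrite rmorphXn.
Qed.

Section Disc.
Variable z : R[i].
Hypothesis z1 : normR z <= 1.

Lemma normR_Xn_le1 k : normR (z ^+ k) <= 1.
Proof. by rewrite normRX exprn_ile1// normR_ge0. Qed.

Lemma normR_1BXn k : normR (1 - z ^+ k) <= k%:R * normR (1 - z).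
Proof.
rewrite -{1}(expr1n _ k) subrXX normRM mulrC ler_wpM2r ?normR_ge0//.
apply: le_trans (normR_sum _ _ _) _.
rewrite -[k in k%:R](card_ord k) -sum1_card natr_sum; apply: ler_sum => i _.
by rewrite expr1n mul1r normR_Xn_le1.
Qed.

Variable M : nat.
Hypothesis M0 : (0 < M)%N.

Let Mr0 : 0 < M%:R :> R. Proof. by rewrite ltr0n. Qed.

Lemma block_poly_le1 : normR (block_poly M).[z] <= 1.
Proof.
rewrite block_polyE normRM normR_real ger0_norm ?invr_ge0//.
rewrite -ler_pdivlMl ?invr_gt0// invrK mulr1.
apply: le_trans (normR_sum _ _ _) _.
rewrite -[M in M%:R](card_ord M) -sum1_card natr_sum; apply: ler_sum => i _.
exact: normR_Xn_le1.
Qed.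

Lemma block_poly_near1 : normR (1 - (block_poly M).[z]) <= 2 * M%:R * normR (1 - z).
Proof.
have -> : 1 - (block_poly M).[z] = (M%:R^-1)%:C * \sum_(k < M) (1 - z ^+ (M + k)).
  rewrite block_polyE sumrB mulrBr sumr_const card_ord; congr (_ - _).
  have -> : (M%:R : R[i]) = (M%:R)%:C by rewrite rmorph_nat.
  by rewrite -rmorphM mulVf ?gt_eqF.
rewrite normRM normR_real ger0_norm ?invr_ge0// ler_pdivrMl//.
apply: le_trans (normR_sum _ _ _) _.
apply: (@le_trans _ _ (\sum_(k < M) (2 * M%:R * normR (1 - z)))); last first.
  by rewrite sumr_const card_ord -[X in X <= _]mulr_natl.
apply: ler_sum => k _; apply: le_trans (normR_1BXn _) _.
rewrite ler_wpM2r ?normR_ge0// -natrM ler_nat; have := ltn_ord k; lia.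
Qed.

(** Multiplied by 1 - z, the sum of the powers z^k telescopes to
    z^M - z^(2 M). *)
Lemma block_poly_decay : normR (block_poly M).[z] * (M%:R * normR (1 - z)) <= 2.
Proof.
rewrite mulrCA -normRM block_polyE -mulrA normRM normR_real ger0_norm ?invr_ge0//.
rewrite mulrA divff ?gt_eqF// mul1r.
have -> : (\sum_(k < M) z ^+ (M + k)) * (1 - z) = z ^+ M * (1 - z ^+ M).
  under eq_bigr do rewrite exprD.
  rewrite -mulr_sumr -mulrA; congr (_ * _); rewrite mulrC.
  rewrite -{2}(expr1n _ M) subrXX; congr (_ * _).
  by apply: eq_bigr => k _; rewrite expr1n mul1r.
rewrite normRM; apply: (@le_trans _ _ (1 * (1 + 1))); last by rewrite mul1r.
apply: ler_pM; rewrite ?normR_ge0 ?normR_Xn_le1//.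
by apply: le_trans (normRB _ _) _; rewrite (normR_real 1) normr1 lerD2l normR_Xn_le1.
Qed.

End Disc.

(** When t is multiplied by 256, this function of t grows by at least a fixed
    proportion of min(t, 1/t). So bounds by min(t, 1/t) along a geometric progression sum up
    by telescoping. *)
Definition squash t : R := t / (1 + t).

(** With t = M |1 - z|, the difference is at most a multiple of t, since both
    polynomials are close to 1, and at most a multiple of 1/t, since both
    decay. *)
Lemma block_poly_gap z M : (0 < M)%N -> normR z <= 1 ->
  normR ((block_poly M).[z] - (block_poly (256 * M)).[z]) <=
  11 * (squash ((256 * M)%:R * normR (1 - z)) - squash (M%:R * normR (1 - z))).
Proof.
move=> M0 z1; have M'0 : (0 < 256 * M)%N by rewrite muln_gt0.
set D := normR (1 - z); have D0 : 0 <= D by exact: normR_ge0.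
set t := M%:R * D; have t0 : 0 <= t by rewrite mulr_ge0.
have e : (256 * M)%:R * D = 256 * t by rewrite natrM mulrA.
have a1 := block_poly_le1 z1 M0; have a2 := block_poly_near1 z1 M0.
have a3 := block_poly_decay z1 M0.
have b1 := block_poly_le1 z1 M'0; have b2 := block_poly_near1 z1 M'0.
have b3 := block_poly_decay z1 M'0.
rewrite -/D -mulrA -/t in a2 a3; rewrite -/D -mulrA e in b2; rewrite -/D e in b3.
rewrite e.
set u := normR _ in a1 a3; set v := normR _ in b1 b3; set d := normR (_ - _).
have u0 : 0 <= u by exact: normR_ge0. have v0 : 0 <= v by exact: normR_ge0.
have d0 : 0 <= d by exact: normR_ge0.
have d1 : d <= u + v by exact: normRB.
have d2 : d <= 2 * (256 * t) + 2 * t.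
  have -> : d = normR ((1 - (block_poly (256 * M)).[z]) - (1 - (block_poly M).[z])).
    by congr normR; ring.
  by apply: le_trans (normRB _ _) _; rewrite lerD.
have -> : squash (256 * t) - squash t = 255 * t / ((1 + t) * (1 + 256 * t)).
  have h1 : 0 < 1 + t by lra. have h2 : 0 < 1 + 256 * t by lra.
  by rewrite /squash; field; rewrite !gt_eqF.
rewrite mulrA ler_pdivlMr; last by rewrite mulr_gt0//; lra.
have dt : d * t <= 4 by nra.
have -> : d * ((1 + t) * (1 + 256 * t)) = d + 257 * t * d + 256 * t * (d * t) by ring.
have h2 : d <= 2 by lra.
have : t * d <= t * 2 by rewrite ler_wpM2l.
have : t * (d * t) <= t * 4 by rewrite ler_wpM2l.
lra.
Qed.

(** The factor 16, the square root of 256, puts the scale M_j halfway, in the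
    logarithmic sense, between the eigenvalues j and j + 1: M_j gap_j = 16 and
    M_j gap_(j+1) = 1/16. *)
Definition scale (j : nat) : nat := (16 * 256 ^ j)%N.

Lemma scale_gt0 j : (0 < scale j)%N.
Proof. by rewrite muln_gt0/= expn_gt0. Qed.

Lemma scaleS j : scale j.+1 = (256 * scale j)%N.
Proof. by rewrite /scale expnS mulnCA. Qed.

(** Each difference is near 1 at the eigenvalue j + 1 and small at the others, so
    that this polynomial nearly takes the value (-1)^l at the eigenvalue l for
    A < l <= A + N. *)
Definition alt_poly (A N : nat) : {poly R[i]} :=
  \sum_(A <= j < A + N) (-1) ^+ j.+1 *: (block_poly (scale j) - block_poly (scale j.+1)).

Lemma alt_poly_disc A N z : normR z <= 1 -> normR (alt_poly A N).[z] <= 11.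
Proof.
move=> z1; pose g j := squash ((scale j)%:R * normR (1 - z)).
rewrite /alt_poly horner_sum.
apply: le_trans (normR_sum _ _ _) _.
apply: (@le_trans _ _ (\sum_(A <= j < A + N) 11 * (g j.+1 - g j))).
  apply: ler_sum => j _; rewrite hornerZ hornerD hornerN normRM.
  rewrite normRX normRN (normR_real 1) normr1 expr1n mul1r /g scaleS.
  exact: block_poly_gap (scale_gt0 j) z1.
rewrite -mulr_sumr telescope_sumr ?leq_addr//.
have D0 : 0 <= normR (1 - z) by exact: normR_ge0.
have gb j : 0 <= g j <= 1.
  have s0 : 0 <= (scale j)%:R * normR (1 - z) by rewrite mulr_ge0.
  rewrite /g /squash divr_ge0 ?addr_ge0//= ler_pdivrMr ?mul1r; last by rewrite ltr_pwDl.
  by rewrite lerDr.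
by have /andP[_ h1] := gb (A + N)%N; have /andP[h2 _] := gb A; lra.
Qed.

Lemma coef_alt_poly A N k : (k < scale A)%N || (2 * scale (A + N) <= k)%N ->
  (alt_poly A N)`_k = 0.
Proof.
move=> hk; rewrite coef_sum big_nat_cond big1// => j; rewrite andbT => /andP[Aj jN].
have sc i l : (i <= l)%N -> (scale i <= scale l)%N.
  by move=> il; rewrite leq_mul2l leq_exp2l.
have h1 := sc _ _ Aj; have h2 := sc _ _ (leqW Aj).
have h3 := sc _ _ (ltnW jN); have h4 := sc _ _ jN.
rewrite coefZ coefD coefN !coef_block_poly.
rewrite (_ : (_ <= k < _)%N = false); last by lia.
by rewrite (_ : (_ <= k < _)%N = false) ?subr0 ?mulr0//; lia.
Qed.

Lemma alt_poly_Hinf A N m n : (m <= scale A)%N -> (2 * scale (A + N) <= n.+1)%N ->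
  Hinf m n (alt_poly A N).
Proof.
move=> hm hn; exists (fun k => (alt_poly A N)`_k) => //; apply/polyP => k.
rewrite coef_sum (eq_bigr (fun j => if j == k then (alt_poly A N)`_j else 0)); last first.
  move=> j _; rewrite coefZ coefXn eq_sym; case: eqP => _; rewrite ?mulr1 ?mulr0//.
have [/andP[mk kn]|h] := boolP (m <= k < n.+1)%N.
  rewrite (bigD1_seq k) ?mem_index_iota ?mk ?iota_uniq//= eqxx big1 ?addr0// => j /negPf -> //.
rewrite coef_alt_poly; last by lia.
rewrite big_nat_cond big1// => j; rewrite andbT => jmn; case: eqP => // jk.
by move: h; rewrite -jk jmn.
Qed.

Section AtNodes.

Lemma block_avg_ge0 M t : 0 <= t -> 0 <= block_avg M t.
Proof. by move=> t0; rewrite mulr_ge0 ?invr_ge0// sumr_ge0// => k _; rewrite exprn_ge0. Qed.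

Lemma block_avg_nonincr M M' t : (0 < M)%N -> (2 * M <= M')%N -> 0 <= t <= 1 ->
  block_avg M' t <= block_avg M t.
Proof.
move=> M0 MM' /andP[t0 t1].
have M'0 : (0 < M')%N by lia.
have avg (K : nat) (c : R) : (0 < K)%N -> K%:R^-1 * \sum_(k < K) c = c.
  by move=> K0; rewrite sumr_const card_ord -[c *+ K]mulr_natl mulKf// pnatr_eq0; lia.
apply: (@le_trans _ _ (t ^+ M')).
  rewrite -[leRHS](avg M')// ler_wpM2l ?invr_ge0//; apply: ler_sum => k _.
  by rewrite ler_wiXn2l// leq_addr.
rewrite -[leLHS](avg M)// ler_wpM2l ?invr_ge0//; apply: ler_sum => k _.
by rewrite ler_wiXn2l//; have := ltn_ord k; lia.
Qed.

Lemma normR_nodeE l : normR (node_fun R l) <= 1.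
Proof. by rewrite normR_real ger0_norm ?node_ge0// node_le1. Qed.

Lemma normR_1Bnode l : normR (1 - node_fun R l) = gap R l.
Proof.
by rewrite /node_fun -(rmorph1 (real_complex R)) -rmorphB normR_real /node opprB addrC subrK ger0_norm// ltW// gap_gt0.
Qed.

Lemma scale_gap j : (scale j)%:R * gap R j = 16.
Proof. by rewrite /scale /gap natrM natrX mulfK// expf_neq0// pnatr_eq0. Qed.

Lemma block_avg_node j :
  3 / 4 <= block_avg (scale j) (node R j.+1) - block_avg (scale j.+1) (node R j.+1).
Proof.
have n01 := node_ge0 R j.+1.
have h1 := block_poly_near1 (normR_nodeE j.+1) (scale_gt0 j).
have h2 := block_poly_decay (normR_nodeE j.+1) (scale_gt0 j.+1).
move: h1 h2; rewrite normR_1Bnode scale_gap /node_fun !block_poly_real.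
have e : (scale j)%:R * gap R j.+1 = 16 / 256 by rewrite gapS mulrA scale_gap.
rewrite -(rmorph1 (real_complex R)) -rmorphB !normR_real -mulrA e => h1 h2.
have := ler_norm (1 - block_avg (scale j) (node R j.+1)).
have := ler_norm (block_avg (scale j.+1) (node R j.+1)).
lra.
Qed.

Definition alt_avg A N t : R :=
  \sum_(A <= j < A + N) (-1) ^+ j.+1 * (block_avg (scale j) t - block_avg (scale j.+1) t).

Lemma alt_poly_real A N t : (alt_poly A N).[t%:C] = (alt_avg A N t)%:C.
Proof.
rewrite /alt_poly horner_sum rmorph_sum; apply: eq_bigr => j _.
by rewrite hornerZ hornerD hornerN !block_poly_real -rmorphB rmorphM rmorphXn rmorphN1.
Qed.

(** On [0, 1] the differences of block polynomials are nonnegative and add up to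
    at most 1. At the node l the difference with index l - 1 is at least 3/4, so
    the other ones, whatever their signs, cannot outweigh it. *)
Lemma alt_avg_node A N l : (A < l <= A + N)%N ->
  2^-1 <= alt_avg A N (node R l) * (-1) ^+ l.
Proof.
case: l => // j /andP[Aj jN]; set t := node R j.+1.
have t01 : 0 <= t <= 1 by rewrite node_ge0 node_le1.
pose w i := block_avg (scale i) t - block_avg (scale i.+1) t.
have w0 i : 0 <= w i.
  rewrite subr_ge0 block_avg_nonincr ?scale_gt0//.
  by rewrite scaleS leq_mul2r orbT.
have wsum : \sum_(A <= i < A + N) w i <= 1.
  rewrite (eq_bigr (fun i => - block_avg (scale i.+1) t - - block_avg (scale i) t)).
    rewrite telescope_sumr ?leq_addr//.
    have := block_avg_ge0 (scale (A + N)) (proj1 (andP t01)).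
    have := block_poly_le1 (normR_nodeE j.+1) (scale_gt0 A).
    rewrite /node_fun block_poly_real normR_real -/t.
    have := ler_norm (block_avg (scale A) t); lra.
  by move=> i _; rewrite /w; ring.
have wj : 3 / 4 <= w j by exact: block_avg_node.
have jm : j \in index_iota A (A + N) by rewrite mem_index_iota -ltnS Aj.
rewrite /alt_avg; move: wsum; rewrite !(bigD1_seq j)//= ?iota_uniq// -/(w j).
set s := \sum_(i <- _ | _) w i => ws.
rewrite mulrDl mulrAC -expr2 sqrr_sign mul1r.
have : - s <= (\sum_(i <- index_iota A (A + N) | i != j)
  (-1) ^+ i.+1 * (block_avg (scale i) t - block_avg (scale i.+1) t)) * (-1) ^+ j.+1.
  rewrite mulr_suml -sumrN; apply: ler_sum => i _; rewrite -/(w i).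
  rewrite mulrAC -exprD -signr_odd; case: odd.
    by rewrite expr1 mulN1r.
  by rewrite expr0 mul1r; have := w0 i; lra.
lra.
Qed.

End AtNodes.
End BlockPolynomials.

(** * The lower bound *)

Section LowerBound.
Variables (R : realType) (al : R).
Hypothesis al01 : 0 < al < 2^-1.

Let T := ritt_op al01.

Let al1 : 0 < al < 1. Proof. exact: lt_half_unit. Qed.

Lemma l2_sum (I : Type) (r : seq I) (F : I -> l2 R) i :
  (\sum_(j <- r) F j) i = \sum_(j <- r) F j i.
Proof. by elim/big_rec2: _ => [|j y1 y2 _ <-]. Qed.

Lemma poly_op_ritt p (x : l2 R) i :
  poly_op p T x i = calc al (fun j => p.[node_fun R j]) x i.
Proof.
rewrite /poly_op l2_sum (@eq_calc _ _ _ (fun j =>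
    \sum_(k < size p) p`_k * node_fun R j ^+ k) _ x)// => [|j _]; last first.
  by rewrite horner_coef.
by rewrite calc_sumf; apply: eq_bigr => k _; rewrite l2Z iter_ritt calcZf.
Qed.

Lemma poly_opZ p a (x : l2 R) : poly_op p T (a *: x) = a *: poly_op p T x.
Proof. by apply: l2P => i; rewrite l2Z !poly_op_ritt -calcZx; exact: eq_calc. Qed.

Lemma opnorm_ge (f : l2 R -> l2 R) (C : R) x :
  (forall a x, f (a *: x) = a *: f x) -> 0 < normR (f x) ->
  C * normR x <= normR (f x) -> (C%:E <= opnorm f)%E.
Proof.
move=> fZ fx0 hC.
have x0 : 0 < normR x.
  rewrite lt_def normR_ge0 andbT; apply: contraTneq fx0 => /normR_eq0 ->.
  by rewrite (_ : f 0 = 0) ?normR0 ?ltxx// -{1}(scale0r (0 : l2 R)) fZ scale0r.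
apply: (@le_trans _ _ (normR (f ((normR x)^-1%:C *: x)))%:E).
  rewrite lee_fin fZ normRZ normR_real ger0_norm ?invr_ge0 ?normR_ge0//.
  by rewrite mulrC ler_pdivlMr.
apply: ereal_sup_ubound; exists ((normR x)^-1%:C *: x) => //=.
rewrite normR_le1 normRZ normR_real ger0_norm ?invr_ge0 ?normR_ge0//.
by rewrite mulVf// gt_eqF.
Qed.

Lemma Cbound_ge m n (p : {poly R[i]}) (C K : R) x :
  0 < K -> Hinf m n p -> (forall z, normR z <= 1 -> normR p.[z] <= K) ->
  0 < normR (poly_op p T x) -> C * normR x <= normR (poly_op p T x) ->
  ((C / K)%:E <= Cbound T m n)%E.
Proof.
move=> K0 [a _ hp] hK px hC; have K1 : 0 < K^-1 by rewrite invr_gt0.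
pose q := (K^-1)%:C *: p.
have qE y : poly_op q T y = (K^-1)%:C *: poly_op p T y.
  apply: l2P => i; rewrite l2Z !poly_op_ritt -calcZf; apply: eq_calc => // j _.
  by rewrite hornerZ.
apply: (@le_trans _ _ (opnorm (poly_op q T))).
  apply: (@opnorm_ge _ _ x); first exact: poly_opZ.
    by rewrite qE normRZ normR_real ger0_norm ?mulr_gt0// ltW.
  by rewrite qE normRZ normR_real (ger0_norm (ltW K1)) mulrAC mulrC ler_pM2l.
apply: ereal_sup_ubound; exists q => //; split.
  exists (fun k => (K^-1)%:C * a k) => //.
  by rewrite /q -hp scaler_sumr; apply: eq_bigr => k _; rewrite scalerA.
apply: ge_ereal_sup => _ [z /= z1 <-]; rewrite lee_fin hornerZ normRM normR_real.
rewrite (ger0_norm (ltW K1)) ler_pdivrMl// mulr1; apply: hK.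
by rewrite -normR_le1 ltW.
Qed.

Lemma Hinf_Xn m n : (m <= n)%N -> Hinf m n ('X^m : {poly R[i]}).
Proof.
move=> mn; exists (fun k => (k == m)%:R) => //.
rewrite (bigD1_seq m) ?mem_index_iota ?leqnn ?ltnS ?iota_uniq//=.
by rewrite eqxx scale1r big1 ?addr0// => k /negPf ->; rewrite scale0r.
Qed.

Lemma alternating_sum (g : nat -> R) n : (forall k, 0 <= g k) ->
  (forall k, g k.+1 <= g k) -> 0 <= \sum_(k < n) (-1) ^+ k * g k <= g 0.
Proof.
elim: n g => [|n IH] g g0 gS; first by rewrite big_ord0 lexx g0.
rewrite big_ord_recl/= expr0 mul1r.
have /andP[h1 h2] := IH (fun k => g k.+1) (fun k => g0 k.+1) (fun k => gS k.+1).
rewrite (eq_bigr (fun k : 'I_n => - ((-1) ^+ k * g k.+1))) => [|k _]; last first.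
  by rewrite exprS mulN1r mulNr.
by have gS0 := gS 0; rewrite sumrN; apply/andP; split; lra.
Qed.

(** S on real sequences: with real entries, signs and cancellation can be
    estimated in the order of R. *)
Definition rconv (d : nat -> R) (i : nat) : R := \sum_(k < i.+1) npow al (i - k) * d k.

Lemma seq_conv_real (d : nat -> R) i :
  seq_conv (npow al) (fun k => (d k)%:C) i = (rconv d i)%:C.
Proof. by rewrite rmorph_sum; apply: eq_bigr => k _; rewrite rmorphM. Qed.

Definition block_support (A N : nat) (d : nat -> R) k : R :=
  if (A < k <= A + N)%N then d k else 0.

Lemma rconv_block A N (d : nat -> R) i :
  rconv (block_support A N d) i =
  \sum_(A.+1 <= k < (minn i (A + N)).+1) npow al (i - k) * d k.
Proof.
rewrite /rconv -(big_mkord xpredT (fun k => npow al (i - k) * block_support A N d k)).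
have [h|h] := leqP (minn i (A + N)) A.
  rewrite [RHS]big_geq// big_nat_cond big1// => k; rewrite andbT /= => ki.
  rewrite /block_support; case: ifP; rewrite ?mulr0//; lia.
rewrite (big_cat_nat (n := A.+1))//=; last by lia.
rewrite big_nat_cond big1 ?add0r => [|k]; last first.
  by rewrite andbT /block_support => kA; case: ifP; rewrite ?mulr0//; lia.
rewrite (big_cat_nat (n := (minn i (A + N)).+1))//=; [|lia|lia].
rewrite [X in _ + X]big_nat_cond [X in _ + X]big1 ?addr0 => [|k]; last first.
  by rewrite andbT /block_support => kA; case: ifP; rewrite ?mulr0//; lia.
rewrite big_nat_cond [RHS]big_nat_cond; apply: eq_bigr => k /andP[kA _].
by rewrite /block_support ifT//; lia.
Qed.

(** Inside the block an alternating sum of the decreasing coefficients is at most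
    the first one, 1; beyond the block it is at most the coefficient at the
    distance to the end of the block. The two cases are written as entries of
    Toeplitz matrices whose column sums are known. *)
Lemma rconv_sign_le A N i :
  rconv (block_support A N (fun k => (-1) ^+ k)) i ^+ 2 <=
  toeplitz (fun k => (k < N)%:R) i A.+1 +
  toeplitz (fun k => npow al k ^+ 2) i (A + N).
Proof.
have b0 k : 0 <= npow al k by rewrite ltW// npow_gt0//; case/andP: al01.
have t1 : 0 <= toeplitz (fun k => (k < N)%:R : R) i A.+1 by apply: toeplitz_ge0.
have t2 : 0 <= toeplitz (fun k => npow al k ^+ 2) i (A + N).
  by apply: toeplitz_ge0 => k; exact: sqr_ge0.
rewrite rconv_block; set L := minn i (A + N).
have [h|h] := leqP L A; first by rewrite big_geq// expr0n addr_ge0.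
have key : (\sum_(A.+1 <= k < L.+1) npow al (i - k) * (-1) ^+ k) ^+ 2 <=
    npow al (i - L) ^+ 2.
  pose g k := npow al (i - L + k).
  have /andP[h1 h2] := @alternating_sum g (L - A) (fun k => b0 _)
    (fun k => eq_ind_r (fun j => npow al j <= _) (npow_noninc _ al1) (addnS _ _)).
  have -> : \sum_(A.+1 <= k < L.+1) npow al (i - k) * (-1) ^+ k =
      (-1) ^+ L * \sum_(k < L - A) (-1) ^+ k * g k.
    rewrite big_nat_rev /= -{1}(add0n A.+1) big_addn subSS big_mkord mulr_sumr.
    apply: eq_bigr => k _; have kL := ltn_ord k.
    have e1 : (i - (A.+1 + L.+1 - (k + A.+1).+1) = i - L + k)%N by lia.
    have e2 : (-1) ^+ L = (-1) ^+ (A.+1 + L.+1 - (k + A.+1).+1 + k) :> R.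
      by congr (_ ^+ _); lia.
    rewrite e1 mulrC mulrA; congr (_ * _).
    by rewrite e2 exprD -mulrA -expr2 sqrr_sign mulr1.
  rewrite exprMn sqrr_sign mul1r lerXn2r ?nnegrE//.
  by move: h2; rewrite /g addn0.
apply: le_trans key _.
have [hi|hi] := leqP i (A + N).
  rewrite [X in X + _](_ : _ = 1); last first.
    have Ai : (A < i)%N by lia.
    have iN : (i - A.+1 < N)%N by lia.
    by rewrite /toeplitz Ai iN.
  have -> : (i - L = 0)%N by lia.
  by rewrite npow0 expr1n lerDl.
rewrite [X in _ + X](_ : _ = npow al (i - L) ^+ 2); first by rewrite lerDr.
have -> : (i - L = i - (A + N))%N by lia.
by rewrite /toeplitz ltnW.
Qed.

Lemma test_vec_sqsum (B : R) A N n :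
  (forall m, \sum_(k < m) npow al k ^+ 2 <= B) ->
  sqsum (fun i => (rconv (block_support A N (fun k => (-1) ^+ k)) i)%:C) n <= N%:R + B.
Proof.
move=> hB; apply: (@le_trans _ _ (\sum_(i < n) toeplitz (fun k => (k < N)%:R) i A.+1 +
  \sum_(i < n) toeplitz (fun k => npow al k ^+ 2) i (A + N))).
  rewrite -big_split; apply: ler_sum => i _.
  by rewrite normR_real real_normK ?num_real// rconv_sign_le.
apply: lerD; apply: toeplitz_col_sum => //; last by move=> k; exact: sqr_ge0.
move=> m; rewrite -natr_sum ler_nat.
elim: m => [|m IH]; first by rewrite big_ord0.
have [Nm|mN] := leqP N m; first by rewrite big_ord_recr/= ltnNge Nm addn0.
apply: leq_trans (mN); rewrite -[X in (_ <= X)%N](card_ord m.+1) -sum1_card.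
by apply: leq_sum => k _; case: (_ < _)%N.
Qed.

Definition test_vec_l2 A N :
  (fun i => (rconv (block_support A N (fun k => (-1) ^+ k)) i)%:C) \in @square_summable R.
Proof.
have [B B0 hB] := npow_square_summable al01.
by apply/square_summableP; exists (N%:R + B) => n; exact: test_vec_sqsum.
Qed.

(** The image under S of the signs (-1)^k on the block A < k <= A + N. Because of
    cancellation its norm is only of order sqrt N. *)
Definition test_vec A N : l2 R := L2 (test_vec_l2 A N).

Lemma test_vec_norm (B : R) A N : (forall m, \sum_(k < m) npow al k ^+ 2 <= B) ->
  normR (test_vec A N) ^+ 2 <= N%:R + B.
Proof.
move=> hB; rewrite normR_l2 sqr_sqrtr ?sqnorm_ge0//; apply: sqnorm_le => n.
exact: test_vec_sqsum.
Qed.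

Lemma poly_op_test_vec p A N i :
  poly_op p T (test_vec A N) i =
  seq_conv (npow al) (fun k => p.[node_fun R k] *
    (block_support A N (fun k => (-1) ^+ k) k)%:C) i.
Proof.
rewrite poly_op_ritt -calc_basis; apply: eq_calc => // k _.
exact/esym/seq_conv_real.
Qed.

Lemma test_vec_gt0 A N : (0 < N)%N -> 0 < normR (test_vec A N).
Proof.
move=> N0; rewrite lt_def normR_ge0 andbT; apply/eqP => /normR_eq0 t0.
have : test_vec A N A.+1 = 0 by rewrite t0.
move=> /(congr1 (@normR R _)); rewrite normR0.
rewrite -[test_vec A N _]/((rconv _ A.+1)%:C) normR_real rconv_block.
rewrite (_ : minn A.+1 (A + N) = A.+1); last by lia.
by rewrite big_nat1 subnn npow0 mul1r normrX normrN normr1 expr1n => /eqP; rewrite oner_eq0.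
Qed.

(** For N = 1 the test vector is an eigenvector of T, and its eigenvalue lambda
    satisfies lambda^m >= 1 - m / 256^(m + 1) >= 1/2. So the monomial z^m gives
    the bound. *)
Lemma Cbound_ge_half m n : (m <= n)%N -> ((2^-1)%:E <= Cbound T m n)%E.
Proof.
move=> mn; have t0 := @test_vec_gt0 m 1 isT.
have e : poly_op 'X^m T (test_vec m 1) = (node R m.+1 ^+ m)%:C *: test_vec m 1.
  apply: l2P => i; rewrite poly_op_test_vec l2Z -[test_vec m 1 i](seq_conv_real _ i) -seq_convZ.
  apply: eq_seq_conv => k _; rewrite hornerXn rmorphXn /block_support.
  case: ifP => [kA|_]; last by rewrite !mulr0.
  by have -> : k = m.+1 by lia.
have node_half : 2^-1 <= node R m.+1 ^+ m.
  have h k : 1 - k%:R * gap R m.+1 <= node R m.+1 ^+ k.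
    elim: k => [|k IH]; first by rewrite mul0r subr0 expr0.
    rewrite exprSr -nat1r; apply: le_trans (ler_wpM2r (node_ge0 R m.+1) IH).
    rewrite /node; have : 0 <= k%:R * gap R m.+1 ^+ 2 by rewrite mulr_ge0// sqr_ge0.
    by move=> h; rewrite -subr_ge0; move: h; congr (0 <= _); ring.
  apply: le_trans (h m); rewrite /gap.
  have : m%:R / 256%:R ^+ m.+1 <= 2^-1 :> R.
    rewrite ler_pdivrMr ?exprn_gt0// -natrX.
    have : (2 * m <= 256 ^ m.+1)%N.
      have := ltn_expl m (isT : (1 < 256)%N); rewrite expnS; lia.
    by rewrite -(ler_nat R) natrM; lra.
  lra.
rewrite -[2^-1]divr1; apply: (@Cbound_ge _ _ 'X^m _ _ (test_vec m 1)) => //.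
- exact: Hinf_Xn.
- by move=> z z1; rewrite hornerXn normRX exprn_ile1// normR_ge0.
- by rewrite e normRZ mulr_gt0// normR_real ger0_norm ?(lt_le_trans _ node_half)// (le_trans _ node_half).
- rewrite e normRZ ler_pM2r// normR_real (le_trans node_half)// ler_norm//.
Qed.

(** The polynomial makes all signs positive, and the sum of the first t + 1
    coefficients of (1 - z)^-al, which is of order (t + 1)^al, is no longer
    diminished by cancellation. *)
Lemma poly_op_test_vec_ge A N t : (t < N)%N ->
  2^-1 * t.+1%:R `^ al <= normR (poly_op (alt_poly R A N) T (test_vec A N) (A + t.+1)%N).
Proof.
move=> tN; rewrite poly_op_test_vec.
rewrite (@eq_seq_conv _ _ _ (fun k => (block_support A N
    (fun k => alt_avg A N (node R k) * (-1) ^+ k) k)%:C)); last first.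
  move=> k _; rewrite /block_support /node_fun alt_poly_real -rmorphM; congr (_%:C).
  by case: ifP; rewrite ?mulr0.
rewrite seq_conv_real normR_real rconv_block.
have al0 : 0 < al by case/andP: al01.
rewrite (_ : minn _ _ = A + t.+1)%N; last by lia.
have key : 2^-1 * \sum_(k < t.+1) npow al k <=
   \sum_(A.+1 <= k < (A + t.+1).+1)
     npow al (A + t.+1 - k) * (alt_avg A N (node R k) * (-1) ^+ k).
  rewrite big_nat_rev /= -{1}(add0n A.+1) big_addn (_ : (A + t.+1).+1 - A.+1 = t.+1)%N; last by lia.
  rewrite big_mkord mulr_sumr; apply: ler_sum => k _; have kt := ltn_ord k.
  rewrite (_ : A + t.+1 - _ = k)%N; last by lia.
  rewrite mulrC ler_pM2l ?npow_gt0// alt_avg_node//; lia.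
apply: le_trans (ler_norm _); apply: le_trans key.
by rewrite npow_sum ler_pM2l ?invr_gt0// npow_rise_ge.
Qed.

(** The exponent 2 al is below 1, so (t / N)^(2 al) >= t / N. *)
Lemma sum_powR_ge (N : nat) : N%:R `^ al ^+ 2 * N%:R <=
  2 * \sum_(t < N) t.+1%:R `^ al ^+ 2 :> R.
Proof.
case: N => [|N]; first by rewrite big_ord0 !mulr0.
set n : R := N.+1%:R; have n0 : 0 < n by rewrite ltr0n.
have /andP[al0 alh] := al01.
have h t : (t <= N.+1)%N -> n `^ al ^+ 2 * (t%:R / n) <= t%:R `^ al ^+ 2.
  move=> tN; set r := t%:R / n; have r0 : 0 <= r by rewrite divr_ge0// ltW.
  have tE : t%:R = n * r by rewrite mulrC divfK// gt_eqF.
  rewrite tE powRM ?(ltW n0)// exprMn ler_wpM2l ?sqr_ge0//.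
  have r1 : r <= 1 by rewrite ler_pdivrMr// mul1r ler_nat.
  rewrite -powR_mulrn ?powR_ge0// -powRrM -{1}[r]powRr1//.
  have [->|rn0] := eqVneq r 0; first by rewrite !powR0 ?gt_eqF//; lra.
  by apply: ger_powR; [rewrite lt_def rn0 r0|lra].
apply: (@le_trans _ _ (2 * \sum_(t < N.+1) n `^ al ^+ 2 * (t.+1%:R / n))); last first.
  by rewrite ler_pM2l//; apply: ler_sum => t _; exact: h.
rewrite -mulr_sumr -mulr_suml mulrCA ler_wpM2l ?sqr_ge0//.
have hs k : (k%:R : R) ^+ 2 <= 2 * \sum_(t < k) t.+1%:R.
  elim: k => [|k IH]; first by rewrite big_ord0 expr0n mulr0.
  by rewrite big_ord_recr/= mulrDr -nat1r; nra.
by rewrite mulrA ler_pdivlMr// -expr2; exact: hs.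
Qed.

(** The square of the norm of the test vector is of order N, and that of its image
    is at least of order N^(1 + 2 al). *)
Lemma Cbound_ge_power : exists2 K, 0 < K & forall A N m n, (0 < N)%N ->
  (m <= scale A)%N -> (2 * scale (A + N) <= n.+1)%N ->
  ((K * N%:R `^ al)%:E <= Cbound T m n)%E.
Proof.
have [B B0 hB] := npow_square_summable al01.
pose D := Num.sqrt (8 * (1 + B)).
have D0 : 0 < D by rewrite sqrtr_gt0 mulr_gt0// addr_gt0.
exists (D^-1 / 11); first by rewrite divr_gt0 ?invr_gt0.
move=> A N m n N0 hm hn; have Nr : 0 < N%:R :> R by rewrite ltr0n.
rewrite mulrAC.
set x := test_vec A N; set y := poly_op (alt_poly R A N) T x.
have P0 : 0 < N%:R `^ al by rewrite powR_gt0.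
have hx : normR x ^+ 2 <= N%:R + B by exact: test_vec_norm.
have hy : N%:R `^ al ^+ 2 * N%:R / 8 <= normR y ^+ 2.
  apply: le_trans (sqsum_le_l2norm y (A.+1 + N)).
  apply: (@le_trans _ _ (\sum_(t < N) (2^-1 * t.+1%:R `^ al) ^+ 2)).
    rewrite (eq_bigr (fun t : 'I_N => 4^-1 * (t.+1%:R `^ al ^+ 2))) => [|t _]; last first.
      by rewrite exprMn; congr (_ * _); field.
    by rewrite -mulr_sumr; have := sum_powR_ge N; lra.
  rewrite /sqsum big_split_ord/= -[leLHS]add0r lerD//.
    by apply: sumr_ge0 => i _; exact: sqr_ge0.
  apply: ler_sum => t _; rewrite lerXn2r ?nnegrE ?normR_ge0 ?mulr_ge0 ?powR_ge0//.
  by rewrite addSnnS; exact: poly_op_test_vec_ge.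
have y0 : 0 < normR y.
  rewrite lt_def normR_ge0 andbT; apply: contraTneq hy => ->.
  by rewrite expr0n -ltNge divr_gt0// mulr_gt0// exprn_gt0.
apply: (@Cbound_ge _ _ (alt_poly R A N) _ _ x) => //.
- exact: alt_poly_Hinf.
- by move=> z; exact: alt_poly_disc.
have C0 : 0 <= D^-1 * N%:R `^ al by rewrite mulr_ge0 ?invr_ge0// ltW.
rewrite -ler_sqr ?nnegrE ?normR_ge0//; last by rewrite mulr_ge0// normR_ge0.
apply: le_trans hy; rewrite !exprMn exprVn sqr_sqrtr; last first.
  by rewrite mulr_ge0// addr_ge0// ltW.
have N1 : 1 <= N%:R :> R by rewrite ler1n.
have hxN : normR x ^+ 2 <= (1 + B) * N%:R by nra.
rewrite -mulrA ler_pdivrMl; last by rewrite mulr_gt0// addr_gt0.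
have -> : 8 * (1 + B) * (N%:R `^ al ^+ 2 * N%:R / 8) =
  N%:R `^ al ^+ 2 * ((1 + B) * N%:R) by field.
by rewrite ler_wpM2l ?sqr_ge0.
Qed.

End LowerBound.

(** * Counting the scales between two degrees *)

Section Counting.

Lemma exists_scale_ge (m : nat) :
  exists A, (m <= scale A)%N && (scale A <= 256 * m.+1)%N.
Proof.
have ex : exists A, (m <= scale A)%N.
  exists m; rewrite /scale; apply: (@leq_trans (256 ^ m)); last exact: leq_pmull.
  exact: ltnW (ltn_expl m _).
exists (ex_minn ex); case: ex_minnP => A hA min; rewrite hA /=.
case: A hA min => [|A] hA min; first by rewrite /scale; lia.
have : ~~ (m <= scale A)%N by apply/negP => /min; rewrite ltnn.
by rewrite scaleS; lia.
Qed.

(** N is the number of scales that fit between the degrees m and n, up to a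
    constant; it is of order log ((n + 1) / (m + 1)). *)
Lemma exists_block_count (m n : nat) : (m <= n)%N -> exists N,
  (n.+1 < m.+1 * 256 ^ (N + 3))%N /\
  ((0 < N)%N -> exists2 A, (m <= scale A)%N & (2 * scale (A + N) <= n.+1)%N).
Proof.
move=> mn; have ex : exists N, (n.+1 < m.+1 * 256 ^ (N + 3))%N.
  exists n.+1; apply: (@leq_trans (256 ^ (n.+1 + 3))); last exact: leq_pmull.
  by rewrite (leq_trans (ltn_expl n.+1 (isT : (1 < 256)%N)))// leq_exp2l// leq_addr.
exists (ex_minn ex); case: ex_minnP => N hN min; split=> // N0.
have : ~~ (n.+1 < m.+1 * 256 ^ (N.-1 + 3))%N by apply/negP => /min; lia.
have [A /andP[mA Am]] := exists_scale_ge m.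
rewrite -leqNgt (_ : N.-1 + 3 = N.+2)%N; last by lia.
rewrite !expnS => h; exists A => //.
have -> : scale (A + N) = (scale A * 256 ^ N)%N by rewrite /scale expnD mulnA.
apply: leq_trans h; rewrite !mulnA leq_mul2r; apply/orP; right.
by move: Am; rewrite /scale; lia.
Qed.

End Counting.

Theorem theorem5p1 (R : realType) :
  exists X : hilbertType R,
  forall delta : R, 0 < delta < 2^-1 ->
  exists T : {linear X -> X},
    [/\ tadmor_ritt T,
        square_function_estimates T &
        exists2 kappa : R, 0 < kappa &
          forall m n : nat, (m <= n)%N ->
            ((kappa * (ln (n.+1%:R / m.+1%:R)) `^ delta)%:E
               <= Cbound T m n)%E].
Proof.
exists (l2 R) => delta d01; exists (ritt_op d01).
split; [exact: ritt_op_tadmor_ritt|exact: ritt_square_function|].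
have [K K0 hK] := Cbound_ge_power d01.
have /andP[d0 d1] := d01.
(* ln ((n + 1) / (m + 1)) <= (N + 3) ln 256 <= (N + 1) L *)
pose L : R := 3 * ln 256.
have L0 : 0 < L by rewrite mulr_gt0// ln_gt0// ltr1n.
pose K' := Num.min 2^-1 (K / 2).
have K'0 : 0 < K'.
  by rewrite /K' lt_min invr_gt0 ltr0n; exact: divr_gt0.
exists (K' / L `^ delta) => [|m n mn]; first by rewrite divr_gt0// powR_gt0.
have [N [hN hA]] := exists_block_count mn.
apply: (@le_trans _ _ (K' * N.+1%:R `^ delta)%:E).
  rewrite lee_fin -mulrA ler_pM2l// ler_pdivrMl ?powR_gt0//.
  rewrite -powRM ?(ltW L0)//; apply: ge0_ler_powR; rewrite ?(ltW d0) ?nnegrE//.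
  - by apply: ln_ge0; rewrite ler_pdivlMr// mul1r ler_nat.
  - by rewrite mulr_ge0// ltW.
  apply: (@le_trans _ _ (ln (256 ^+ (N + 3)))).
    rewrite ler_ln ?posrE ?divr_gt0 ?exprn_gt0// ler_pdivrMr// -natrX -natrM ler_nat.
    by rewrite mulnC ltnW.
  rewrite lnXn//.
  have -> : ln (256 : R) *+ (N + 3) = ln 256 * (N + 3)%:R by rewrite mulr_natr.
  have -> : L * N.+1%:R = ln 256 * (3 * N.+1)%:R by rewrite /L natrM; ring.
  by rewrite ler_pM2l ?ln_gt0 ?ltr1n// ler_nat; lia.
have [N0|N0] := leqP N 0.
  have -> : N = 0%N by lia.
  apply: le_trans (Cbound_ge_half d01 mn).
  by rewrite lee_fin powR1 mulr1 ge_min lexx.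
have [A mA An] := hA N0.
apply: le_trans (hK A N m n N0 mA An); rewrite lee_fin.
apply: (@le_trans _ _ (K / 2 * N.+1%:R `^ delta)).
  by rewrite ler_wpM2r ?powR_ge0// ge_min lexx orbT.
rewrite -mulrA ler_pM2l// ler_pdivrMl//.
apply: (@le_trans _ _ ((2 * N%:R) `^ delta)).
  apply: ge0_ler_powR; rewrite ?(ltW d0) ?nnegrE//.
  by rewrite -natrM ler_nat; lia.
rewrite powRM// ler_wpM2r ?powR_ge0//.
rewrite -[leRHS]powRr1//; apply: ler_powR; first by rewrite ler1n.
lra.
Qed.
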